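(* Let $k\in\mathbb N$, $r\in\mathbb N_0$, $1\le p\le\infty$, and let $\alpha,\beta\in\mathbb R$ satisfy $r/2+\alpha\ge0$ and $r/2+\beta\ge0$. If $f\in\mathbb B^{r+1}_p(w_{\alpha,\beta})$, then $$\omega_{k+1,r}^\varphi(f^{(r)},t)_{\alpha,\beta,p}\le c\,t\,\omega_{k,r+1}^\varphi(f^{(r+1)},t)_{\alpha,\beta,p},\qquad t>0,$$ where $c$ depends only on $k,r,p,\alpha,\beta$.
   Context: Notation. $\mathbb N_0=\mathbb N\cup\{0\}$. For a measurable set $I\subseteq[-1,1]$ and measurable $f$, $\|f\|_{L_p(I)}=(\int_I|f|^p\,dx)^{1/p}$ for $p<\infty$ and $\|f\|_{L_\infty(I)}=\operatorname{ess\,sup}_{I}|f|$; $\|\cdot\|_p=\|\cdot\|_{L_p[-1,1]}$. For a weight $w$, $L_{w,p}=\{f:\|wf\|_p<\infty\}$. $\varphi(x)=\sqrt{1-x^2}$. $w_{\alpha,\beta}(x)=(1-x)^\alpha(1+x)^\beta$. Spaces: $\mathbb B^0_p(w)=L_{w,p}$ and, for $r\ge1$, $\mathbb B^r_p(w)=\{f: f^{(r-1)}\in AC_{loc}(-1,1)\text{ and }\varphi^rf^{(r)}\in L_{w,p}\}$, where $AC_{loc}(-1,1)$ is the set of functions locally absolutely continuous in $(-1,1)$. Differences: $\Delta_h^k(f,x)=\sum_{i=0}^k\binom ki(-1)^{k-i}f(x-\frac{kh}2+ih)$ if $[x-\frac{kh}2,x+\frac{kh}2]\subseteq[-1,1]$,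 and $\Delta_h^k(f,x)=0$ otherwise. Weights and domains: $\mathcal W_\delta^{\xi,\zeta}(x)=(1-x-\delta\varphi(x)/2)^\xi(1+x-\delta\varphi(x)/2)^\zeta$; for $\delta>0$, $\mathfrak D_\delta=\{x: 1-\delta\varphi(x)/2\ge|x|\}\setminus\{\pm1\}=\{x:|x|\le\frac{4-\delta^2}{4+\delta^2}\}$ (empty if $\delta>2$). Modulus: for $k\in\mathbb N$, $r\in\mathbb N_0$ and $f\in\mathbb B^r_p(w_{\alpha,\beta})$, $$\omega_{k,r}^\varphi(f^{(r)},t)_{\alpha,\beta,p}=\sup_{0<h\le t}\big\|\mathcal W_{kh}^{r/2+\alpha,r/2+\beta}(\cdot)\,\Delta^k_{h\varphi(\cdot)}(f^{(r)},\cdot)\big\|_{L_p(\mathfrak D_{kh})}.$$ *)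

(* Defs.v *)
From HB Require Import structures.
From mathcomp Require Export all_boot all_order all_algebra.
From mathcomp Require Export all_classical all_reals all_analysis.
Export numFieldNormedType.Exports.
Set Implicit Arguments.
Unset Strict Implicit.
Unset Printing Implicit Defensive.
Import Order.TTheory GRing.Theory Num.Theory.
Local Open Scope classical_set_scope.
Local Open Scope ring_scope.

Section Defs.
Context {R : realType}.
Implicit Types (f g : R -> R) (I : set R) (p : \bar R).

(* ||f||_{L_p(I)}, obtained by extending f by 0 outside I; for p = +oo this is
   the essential supremum. *)
Definition Lpnorm p I f : \bar R :=
  Lnorm (@lebesgue_measure R) p (EFin \o (f \_ I)).

Definition phi (x : R) : R := Num.sqrt (1 - x ^+ 2).

Definition jacobi_weight (alpha beta : R) (x : R) : R :=
  (1 - x) `^ alpha * (1 + x) `^ beta.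

(* Measurability is Borel measurability.  This excludes no Lebesgue class, and
   it costs nothing for a derivative: the everywhere-defined derive1 g of a function
   g that is continuous on (-1, 1) is Borel on (-1, 1). *)
Definition weighted_Lp (w : R -> R) p (f : R -> R) : Prop :=
  measurable_fun (`[(-1)%R, 1%R] : set R) f /\
  (Lpnorm p `[(-1)%R, 1%R] (fun x => w x * f x)%R < +oo)%E.

Definition abs_continuous_on (a b : R) (f : R -> R) : Prop :=
  forall eps : R, 0 < eps -> exists2 delta : R, 0 < delta &
    forall (n : nat) (u v : 'I_n -> R),
      (forall i, [/\ a <= u i, u i <= v i & v i <= b]) ->
      trivIset setT (fun i => `]u i, v i[%classic) ->
      \sum_(i < n) (v i - u i) < delta ->
      \sum_(i < n) `|f (v i) - f (u i)| < eps.

Definition AC_loc (f : R -> R) : Prop :=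
  forall a b : R, -1 < a -> a <= b -> b < 1 -> abs_continuous_on a b f.

(* derive1n n f is a total function; the derivative of g is 0 where g is not
   differentiable.  The existence of f', ..., f^(r-1) on (-1, 1), implicit in
   the condition f^(r-1) \in AC_loc, is therefore stated separately; f^(r) exists
   only almost everywhere, and its value on the exceptional null set plays no
   role.  Values of f outside (-1, 1) are likewise irrelevant when r > 0. *)
Definition in_B (r : nat) (w : R -> R) p (f : R -> R) : Prop :=
  if r is r'.+1 then
    [/\ forall (j : nat) (x : R), (j < r')%N -> -1 < x < 1 ->
          derivable (derive1n j f) x 1,
        AC_loc (derive1n r' f) &
        weighted_Lp w p (fun x => phi x ^+ r * derive1n r f x)]
  else weighted_Lp w p f.

Definition sym_diff (k : nat) (h : R) (f : R -> R) (x : R) : R :=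
  if `[< `[x - k%:R * h / 2, x + k%:R * h / 2] `<=` `[(-1)%R, 1%R] >] then
    \sum_(i < k.+1)
      'C(k, i)%:R * (-1) ^+ (k - i) * f (x - k%:R * h / 2 + i%:R * h)
  else 0.

Definition shifted_weight (delta xi zeta : R) (x : R) : R :=
  (1 - x - delta * phi x / 2) `^ xi * (1 + x - delta * phi x / 2) `^ zeta.

Definition domD (delta : R) : set R :=
  [set x | 1 - delta * phi x / 2 >= `|x|] `\` [set -1; 1].

(* omega_{k,r}^phi(g, t)_{alpha,beta,p}, to be used with g = f^(r). *)
Definition modulus (k r : nat) (g : R -> R) (t alpha beta : R) p : \bar R :=
  ereal_sup [set Lpnorm p (domD (k%:R * h))
      (fun x => shifted_weight (k%:R * h) (r%:R / 2 + alpha) (r%:R / 2 + beta) x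
                * sym_diff k (h * phi x) g x)
    | h in [set h : R | 0 < h <= t]].

End Defs.

(* Main.v *)
(* Write K = k + 1, g = f^(r), G = g', and let I be the interval of centre x and
   length K h phi(x).  Subdividing the step and averaging the identity
     sum_{i,j} (-1)^(i+j) C(K,i) C(K,j) g(x + i (H - j v)) = sum over either index first
   over v bounds |Delta^K g(x)|, of step h phi(x), by c / (h phi(x)) times the integral of
   |Delta_s^k G(y)| over the (s, y) with s comparable to h phi(x) and
   [y - ks/2, y + ks/2] contained in I.  In the variables (y, s / phi(y)) this is
   an integral operator whose kernel, after division by the weights, has both marginals
   controlled: of order h when integrated over (y, s / phi(y)), because the weights
   exceed by sqrt((1 - y - ks/2)(1 + y - ks/2)) at y those at x and
   this square root has an integrable inverse, and of order 1 when integrated over x,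
   because the admissible x stay in a set of diameter comparable to the distance of
   [y - ks/2, y + ks/2] to the boundary.  Schur's test then gives the factor h for every
   1 <= p <= oo.  The fundamental theorem of calculus for absolutely continuous
   functions comes from Radon-Nikodym applied to the Stieltjes measures of a monotone
   decomposition. *)
From HB Require Import structures.
From mathcomp Require Import ring lra zify.
Require Import Defs.
From mathcomp Require Import measurable_realfun ess_sup_inf.
Set Implicit Arguments.
Unset Strict Implicit.
Unset Printing Implicit Defensive.
Import Order.TTheory GRing.Theory Num.Theory.
Local Open Scope classical_set_scope.
Local Open Scope ring_scope.

(** * Absolutely continuous functions *)

(** A difference of g with constant step is an integral of differences of G with the same constant
    step, whereas the modulus of G only sees steps proportional to phi(y). A single step s therefore
    cannot be compared with the modulus directly. Once s is averaged as well, the substitution s =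
    tau phi(y) cuts the (y, s) region into slices of constant tau, and each slice is dominated by
    one of the functions whose norm enters [modulus]. The exchange identity makes the averaging
    possible: its steps vary with v while its nodes stay in the stencil of the original difference,
    so that g and G are only used inside (-1, 1).

    Slices with tau > h would be useless, and phi(y) can be much smaller than phi(x) near an
    endpoint. Hence the subdivision: taking s smaller than h phi(x) by a factor m costs a power of m
    and forces tau <= h, so that the modulus on the right is taken at t itself and not at a multiple
    of t. *)

Section absolute_continuity.
Context {R : realType}.
Implicit Types (a b u v : R) (F : R -> R) (s t : seq (R * R)).

Definition nonoverlapping (p q : R * R) : bool := (p.2 <= q.1) || (q.2 <= p.1).

Definition subsegment a b (p : R * R) : bool := [&& a <= p.1, p.1 <= p.2 & p.2 <= b].

(** Lists replace indexed families because the variation argument below refines and concatenates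
    collections of segments. *)
Lemma abs_continuous_on_seq a b F : abs_continuous_on a b F ->
  forall eps, 0 < eps -> exists2 delta, 0 < delta & forall s,
    pairwise nonoverlapping s -> all (subsegment a b) s ->
    \sum_(p <- s) (p.2 - p.1) < delta -> \sum_(p <- s) `|F p.2 - F p.1| < eps.
Proof.
move=> acF eps /acF[delta delta0 acd]; exists delta => // s ds /allP sab slt.
have := acd (size s) (fun i => (tnth (in_tuple s) i).1) (fun i => (tnth (in_tuple s) i).2).
rewrite -(big_tnth _ _ _ xpredT (fun p => `|F p.2 - F p.1|)).
rewrite -(big_tnth _ _ _ xpredT (fun p => p.2 - p.1)); apply => //.
- by move=> i; apply/and3P; apply: sab; exact: mem_tnth.
- apply/trivIsetP => /= i j _ _.
  wlog ij : i j / (i < j)%N => [wl|].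
    rewrite neq_ltn => /orP[ij|ji]; first by apply: wl => //; rewrite neq_ltn ij.
    by rewrite setIC; apply: wl => //; rewrite neq_ltn ji.
  move=> _; move/(pairwiseP (0, 0)) : ds => /(_ i j).
  rewrite !inE => /(_ (ltn_ord i) (ltn_ord j) ij).
  rewrite -[nth _ s i](tnth_nth _ (in_tuple s)) -[nth _ s j](tnth_nth _ (in_tuple s)).
  move=> /orP d; rewrite -subset0 => x /= []; rewrite !in_itv/=.
  by case: d => d; lra.
Qed.

Lemma zip_itv_partition u v (l : seq R) : itv_partition u v l ->
  [/\ pairwise nonoverlapping (zip (u :: l) l), all (subsegment u v) (zip (u :: l) l) &
    \sum_(p <- zip (u :: l) l) (p.2 - p.1) = v - u].
Proof.
elim: l u => [u /itv_partition_nil ->|x l ih u pl].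
  by rewrite /= big_nil subrr.
have [ds sv lv] := ih _ (itv_partition_cons pl).
have xv := itv_partition_le (itv_partition_cons pl).
have ux : u < x by case: pl => /= /andP[].
split.
- rewrite [zip _ _]/= pairwise_cons ds andbT; apply/allP => p /(allP sv) /and3P[xp _ _].
  by apply/orP; left.
- rewrite [zip _ _]/= /=; apply/andP; split; first by apply/and3P; split => //; exact: ltW.
  by apply: sub_all sv => p /and3P[p1 p2 p3]; apply/and3P; split=> //; lra.
- by rewrite [zip _ _]/= big_cons lv /=; lra.
Qed.

Lemma pairwise_nonoverlapping_subst (u v : R) s t :
  pairwise nonoverlapping ((u, v) :: s) -> pairwise nonoverlapping t ->
  all (subsegment u v) t -> pairwise nonoverlapping (s ++ t).
Proof.
rewrite pairwise_cons pairwise_cat => /andP[/allP us ds] dt /allP tu.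
rewrite ds dt andbT/= andbT; apply/allrelP => p q ps qt.
have /orP/= := us _ ps; have /and3P/= := tu _ qt.
by rewrite /nonoverlapping => -[q1 q2 q3] [h|h]; apply/orP; [right|left]; lra.
Qed.

(** Variations are traded for increments one segment at a time: [s] holds the segments still
    measured by their variation, [t] the pieces already cut. Cutting a segment preserves
    disjointness and total length, so the same [delta] serves throughout; taking suprema over
    partitions makes the final inequality non-strict. *)
Lemma sum_total_variation_le a b F (delta eps : R) :
  (forall s, pairwise nonoverlapping s -> all (subsegment a b) s ->
    \sum_(p <- s) (p.2 - p.1) < delta -> \sum_(p <- s) `|F p.2 - F p.1| < eps) ->
  forall s t, pairwise nonoverlapping (s ++ t) -> all (subsegment a b) (s ++ t) ->
    \sum_(p <- s ++ t) (p.2 - p.1) < delta ->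
    (\sum_(p <- s) total_variation p.1 p.2 F + (\sum_(p <- t) `|F p.2 - F p.1|)%:E
      <= eps%:E)%E.
Proof.
move=> acF; elim => [t ds sab sd|[u v] s ih t ds sab sd].
  by rewrite big_nil add0e lee_fin ltW// acF.
have uv : u <= v by move: sab => /= /andP[/and3P[]].
(* Being finite, these terms can be moved to the right side, which isolates the variation of
   [(u, v)] as a supremum. *)
have fin : ((\sum_(p <- s) total_variation p.1 p.2 F) + (\sum_(p <- t) `|F p.2 - F p.1|)%:E
    \is a fin_num)%E.
  rewrite ge0_fin_numE; last first.
    apply: adde_ge0; last by rewrite lee_fin sumr_ge0.
    rewrite big_seq; apply: sume_ge0 => p ps; apply: total_variation_ge0.
    by move: sab => /= /andP[_]; rewrite all_cat => /andP[/allP/(_ p ps) /and3P[]].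
  move: sab ds sd => /= /andP[_ sab] /andP[_ ds]; rewrite big_cons/= => sd.
  rewrite (le_lt_trans (ih t ds sab _)) ?ltry//.
  by apply: le_lt_trans sd; rewrite lerDr subr_ge0.
rewrite big_cons/= -addeA -leeBrDr//.
apply: ge_ereal_sup => _ [_ [l pl <-] <-].
have [dl ll Sl] := zip_itv_partition pl.
rewrite leeBrDr//.
rewrite variation_zip // addeCA -EFinD.
have := ih (t ++ zip (u :: l) l); rewrite !big_cat/= (addrC (\sum_(p <- t) `|_|)).
have -> : \sum_(x <- zip l (u :: l)) `|F x.1 - F x.2| =
          \sum_(x <- zip (u :: l) l) `|F x.2 - F x.1|.
  have -> : zip l (u :: l) = [seq (p.2, p.1) | p <- zip (u :: l) l].
    elim: l (u :: l) {pl dl ll Sl} => [[]//|x l' ih' [//|y l'' /=]].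
    by rewrite ih'.
  by rewrite big_map.
apply.
- by rewrite catA; apply: pairwise_nonoverlapping_subst dl ll.
- rewrite catA all_cat; move: sab => /= /andP[/and3P[/= p1 p2 p3] ->] /=.
  by apply: sub_all ll => q /and3P[q1 q2 q3]; apply/and3P; split => //; lra.
- by rewrite Sl; move: sd; rewrite /= big_cons big_cat/=; lra.
Qed.

End absolute_continuity.

(** * Monotone decomposition and null sets of Stieltjes measures *)

Section monotone_decomposition.
Context {R : realType}.
Implicit Types (a b u v : R) (F H : R -> R) (s t : seq (R * R)).

(** Steps of half the [delta] that belongs to eps = 1 add at most 1 each to the variation, so it is
    at most the number of steps. *)
Lemma abs_continuous_total_variation_lty a b F : a <= b -> abs_continuous_on a b F ->
  (total_variation a b F < +oo)%E.
Proof.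
move=> ab /abs_continuous_on_seq/(_ _ ltr01)[d d0 acF].
suff H n c : a <= c -> c <= b -> c - a <= d / 2 * n%:R ->
    (total_variation a c F <= n%:R%:E)%E.
  apply: (le_lt_trans (H (Num.trunc ((b - a) / (d / 2))).+1 b _ _ _)) => //.
    rewrite -ler_pdivrMl ?divr_gt0// mulrC.
    by apply/ltW/truncnS_gt.
  by rewrite ltry.
elim: n c => [c ac _|n ih c ac cb cad].
  rewrite mulr0 => ca; have -> : c = a by lra.
  by rewrite total_variationxx.
pose c' := Num.max a (c - d / 2).
have ac' : a <= c' by rewrite le_max lexx.
have c'c : c' <= c by rewrite ge_max ac/=; lra.
rewrite (total_variationD F ac' c'c) -natr1 EFinD leeD//.
  apply: ih => //; first lra.
  rewrite /c'; case: (leP a (c - d/2)) => ?; last by rewrite subrr mulr_ge0//; lra.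
  by move: cad; rewrite -natr1; lra.
have := @sum_total_variation_le _ a b F d 1 acF [:: (c', c)] [::].
rewrite /= !big_cons !big_nil ?addr0 ?adde0; apply => //.
  by rewrite andbT /subsegment/= ac' c'c cb.
by rewrite /=/c'; case: (leP a (c - d/2)) => ?; lra.
Qed.

(** Meant for nondecreasing H, hence no absolute values; it concerns the whole line because the
    Stieltjes measure of H does. *)
Definition uniformly_abs_continuous H := forall eps, 0 < eps ->
  exists2 delta, 0 < delta & forall s, pairwise nonoverlapping s ->
    all (fun p => p.1 <= p.2) s -> \sum_(p <- s) (p.2 - p.1) < delta ->
    \sum_(p <- s) (H p.2 - H p.1) <= eps.

(** V is the variation from [a] and U = V - F, both made constant outside [a, b] by the clamp [cl].
    Increments of F are bounded by those of V, so increments of U are at most twice those of V; this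
    is the origin of e / 2 in the proof. *)
Lemma abs_continuous_nondecreasing_decomposition a b F : a <= b -> abs_continuous_on a b F ->
  exists V U : R -> R, [/\ {homo V : x y / x <= y}, {homo U : x y / x <= y},
    uniformly_abs_continuous V, uniformly_abs_continuous U &
    forall x, a <= x <= b -> F x = V x - U x].
Proof.
move=> ab acF.
have TVfin u v : a <= u -> u <= v -> v <= b -> total_variation u v F \is a fin_num.
  move=> au uv vb; apply/bounded_variationP => //.
  apply: (bounded_variationl _ vb) => //.
  apply: (bounded_variationr au (le_trans uv vb)).
  apply/bounded_variationP => //.
  by rewrite ge0_fin_numE ?abs_continuous_total_variation_lty// total_variation_ge0.
pose cl x := Num.min b (Num.max a x).
have cla x : a <= cl x by rewrite le_min ab le_max lexx.
have clb x : cl x <= b by rewrite ge_min lexx.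
have cln x y : x <= y -> cl x <= cl y.
  by move=> xy; rewrite /cl le_min ge_min lexx/= ge_min ge_max !le_max lexx xy orbT orbT.
have clL x y : x <= y -> cl y - cl x <= y - x.
  move=> xy; rewrite /cl.
  by case: (leP a x); case: (leP a y); case: (leP b x); case: (leP b y); case: (leP b a); lra.
have clid x : a <= x <= b -> cl x = x.
  by move=> /andP[ax xb]; rewrite /cl max_r// min_r.
pose V x := fine (total_variation a (cl x) F).
have VB u v : u <= v -> V v - V u = fine (total_variation (cl u) (cl v) F).
  move=> uv; rewrite /V (total_variationD F (cla u) (cln _ _ uv)) fineD ?TVfin//.
    by rewrite addrC addKr.
  exact: cln.
have VF u v : u <= v -> `|F (cl v) - F (cl u)| <= V v - V u.
  move=> uv; rewrite VB// -lee_fin fineK; last by rewrite TVfin// cln.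
  by apply: total_variation_ge; exact: cln.
have Vsum eps : 0 < eps -> exists2 delta, 0 < delta & forall s, pairwise nonoverlapping s ->
    all (fun p => p.1 <= p.2) s -> \sum_(p <- s) (p.2 - p.1) < delta ->
    \sum_(p <- s) (V p.2 - V p.1) <= eps.
  move=> /(abs_continuous_on_seq acF)[d d0 acd]; exists d => // s ds s12 sd.
  have := sum_total_variation_le acd (s := [seq (cl p.1, cl p.2) | p <- s]) (t := [::]).
  rewrite cats0 !big_map big_nil/= adde0.
  have -> : (\sum_(p <- s) total_variation (cl p.1) (cl p.2) F =
             (\sum_(p <- s) (V p.2 - V p.1))%:E)%E.
    rewrite -sumEFin big_seq [RHS]big_seq; apply: eq_bigr => p /(allP s12) p12.
    by rewrite VB// fineK// TVfin// cln.
  rewrite lee_fin; apply.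
  - rewrite pairwise_map; apply: sub_pairwise ds => p q /orP[h|h]; apply/orP; [left|right];
      exact: cln.
  - rewrite all_map; apply: sub_all s12 => p p12.
    by rewrite /subsegment/= cla clb cln.
  - apply: le_lt_trans sd; rewrite big_seq [leRHS]big_seq.
    by apply: ler_sum => p /(allP s12) p12; rewrite clL.
exists V, (fun x => V x - F (cl x)); split.
- by move=> x y xy; have := VF _ _ xy; have := normr_ge0 (F (cl y) - F (cl x)); lra.
- by move=> x y xy; have := VF _ _ xy; have := ler_norm (F (cl y) - F (cl x)); lra.
- exact: Vsum.
- move=> e e0; have [|d d0 Vd] := Vsum (e / 2); first by rewrite divr_gt0.
  exists d => // s ds s12 sd.
  have := Vd s ds s12 sd => Vs.
  rewrite (@le_trans _ _ (2 * \sum_(p <- s) (V p.2 - V p.1)))//; last lra.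
  rewrite mulr_sumr big_seq [leRHS]big_seq; apply: ler_sum => p /(allP s12) p12.
  have := VF _ _ p12.
  by have := ler_norm (- (F (cl p.2) - F (cl p.1))); rewrite normrN; lra.
- by move=> x xab; rewrite clid//; lra.
Qed.

Lemma uniformly_abs_continuous_right_continuous H : {homo H : x y / x <= y} ->
  uniformly_abs_continuous H -> right_continuous H.
Proof.
move=> ndH acH x; apply/cvgrPdist_le => e e0.
have [d d0 Hd] := acH _ e0.
near=> y.
have xy : x < y by near: y; exact: nbhs_right_gt.
have yd : y < x + d by near: y; apply: nbhs_right_lt; lra.
have := Hd [:: (x, y)]; rewrite !big_cons !big_nil !addr0/= => h.
rewrite distrC ger0_norm ?subr_ge0; last exact/ndH/ltW.
by apply: h => //; rewrite ?ltW//=; lra.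
Unshelve. all: by end_near. Qed.

(** Finite measure excludes unbounded intervals, whose [inf] or [sup] would not be an endpoint. *)
Lemma open_interval_finite_measure (I : set R) : open I -> is_interval I -> I !=set0 ->
  (lebesgue_measure I < +oo)%E ->
  inf I < sup I /\ I = `](inf I), (sup I)[%classic.
Proof.
move=> oI iI I0 Ioo.
have fI : lebesgue_measure I \is a fin_num by rewrite ge0_fin_numE.
have mI : measurable I by exact: open_measurable.
have key x y : I x -> I y -> x <= y -> y - x <= fine (lebesgue_measure I).
  move=> Ix Iy xy; rewrite -lee_fin fineK//.
  apply: (@le_trans _ _ (lebesgue_measure (`[x, y] : set R))).
    rewrite lebesgue_measure_itv/= lte_fin; case: ltP => // yx.
    by rewrite lee_fin; lra.
  apply: le_measure; rewrite ?inE//.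
  by move=> z /=; rewrite in_itv/= => xyz; exact: (iI x y).
have [x0 Ix0] := I0.
have lbI : has_lbound I.
  exists (x0 - fine (lebesgue_measure I)) => y Iy.
  have [xy|/ltW yx] := leP x0 y; last by have := key _ _ Iy Ix0 yx; lra.
  by have := key _ _ Ix0 Ix0 (lexx _); lra.
have ubI : has_ubound I.
  exists (x0 + fine (lebesgue_measure I)) => y Iy.
  have [xy|/ltW yx] := leP x0 y; first by have := key _ _ Ix0 Iy xy; lra.
  by have := key _ _ Ix0 Ix0 (lexx _); lra.
have eI : I = `](inf I), (sup I)[%classic.
  have := interval_bounded_interior iI lbI ubI; rewrite ((interior_id I).1 oI) => e.
  by rewrite [LHS]e; apply/seteqP; split => x /=; rewrite in_itv.
split=> //.
have : `](inf I), (sup I)[%classic x0 by rewrite -eI.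
by rewrite /= in_itv/= => /andP[]; exact: lt_trans.
Qed.

Lemma stieltjes_measure_itv (H : cumulative R R) u v : u <= v ->
  lebesgue_stieltjes_measure H `]u, v]%classic = (H v - H u)%:E.
Proof.
move=> uv; rewrite /lebesgue_stieltjes_measure /measure_extension.
rewrite measurable_mu_extE/=; last exact: is_ocitv.
by rewrite wlength_itv_bnd.
Qed.

(** A null set lies in an open set of length below [d]. Over any finitely many components of that
    set H gains at most [e], and countable additivity passes this bound to their union. *)
Lemma stieltjes_null_dominates (H : cumulative R R) : uniformly_abs_continuous H ->
  lebesgue_stieltjes_measure H `<< @lebesgue_measure R.
Proof.
move=> acH; apply/null_content_dominatesP => A mA A0.
pose nu : {measure set (measurableTypeR R) -> \bar R} := lebesgue_stieltjes_measure H.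
rewrite -[lebesgue_stieltjes_measure H]/(nu : set R -> \bar R).
apply/eqP; rewrite eq_le measure_ge0 andbT; apply/lee_addgt0Pr => e e0; rewrite add0e.
have [d d0 Hd] := acH _ e0.
have [|U [oU AU UAd]] := lebesgue_regularity_outer mA _ d0.
  by rewrite [X in (X < _)%E]A0 ltry.
have mU : measurable U by exact: open_measurable.
have Ud : (lebesgue_measure U < d%:E)%E.
  rewrite -(setDUK AU) measureU//; last 2 first.
  - exact: measurableD.
  - by rewrite setDIK.
  by rewrite [X in (X + _ < _)%E]A0 add0e.
apply: (@le_trans _ _ (nu U)); first by apply: le_measure; rewrite ?inE.
pose I := open_disjoint_itv oU.
have oI i : open (I i) by exact: open_disjoint_itv_open.
have iI i : is_interval (I i) by exact: open_disjoint_itv_is_interval.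
have mI i : measurable (I i) by exact: open_measurable.
have UI : U = \bigcup_(i in setT) I i by exact: open_disjoint_itv_bigcup.
have tI : trivIset setT I by exact: open_disjoint_itv_trivIset.
have IU i : I i `<=` U by rewrite UI; exact: bigcup_sup.
have Ilty i : (lebesgue_measure (I i) < +oo)%E.
  apply: (@le_lt_trans _ _ (lebesgue_measure U)).
    by apply: le_measure; rewrite ?inE//; exact: mI.
  by rewrite (lt_trans Ud)// ltry.
rewrite UI measure_bigcup//; last by move=> i _; exact: mI.
under eq_eseriesl do rewrite in_setT.
apply: lime_le; first exact: is_cvg_nneseries.
near=> n.
(* Empty components are dropped: their [inf] and [sup] are default values that could fall inside
   another component. *)
pose s := [seq (inf (I i), sup (I i)) | i <- iota 0 n & `[< I i !=set0 >]].
have In0 i : ~ (I i !=set0) -> I i = set0 by move=> /set0P/negP/negPn/eqP.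
have Pn : [/\ pairwise nonoverlapping s, all (fun p => p.1 <= p.2) s &
  \sum_(p <- s) (p.2 - p.1) < d].
  split.
  - rewrite /s pairwise_map; apply/(pairwiseP 0%N) => i j.
    set l := [seq _ <- _ | _].
    rewrite !inE => il jl ij.
    have ul : uniq l by rewrite filter_uniq// iota_uniq.
    have := mem_nth 0%N il; rewrite mem_filter => /andP[/asboolP Ii _].
    have := mem_nth 0%N jl; rewrite mem_filter => /andP[/asboolP Ij _].
    have nij : nth 0%N l i != nth 0%N l j by rewrite nth_uniq//; lia.
    have {tI} := trivIsetP.1 tI _ _ Logic.I Logic.I nij.
    have [ij1 e1] := open_interval_finite_measure (oI _) (iI _) Ii (Ilty _).
    have [ij2 e2] := open_interval_finite_measure (oI _) (iI _) Ij (Ilty _).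
    rewrite {1}e1 {1}e2 -subset0 /nonoverlapping/=.
    move=> dij; apply/negPn/negP; rewrite negb_or -!ltNge => /andP[u1 u2].
    have := dij ((Num.max (inf (I (nth 0%N l i))) (inf (I (nth 0%N l j))) +
              Num.min (sup (I (nth 0%N l i))) (sup (I (nth 0%N l j)))) / 2).
    apply; rewrite /= !in_itv/=.
    case: (leP (inf (I (nth 0%N l i))) (inf (I (nth 0%N l j)))) => ?;
    case: (leP (sup (I (nth 0%N l i))) (sup (I (nth 0%N l j)))) => ?; lra.
  - apply/allP => p /mapP[i]; rewrite mem_filter => /andP[/asboolP Ii _] ->/=.
    by have [/ltW] := open_interval_finite_measure (oI _) (iI _) Ii (Ilty _).
  - rewrite -lte_fin; apply: le_lt_trans Ud.
    rewrite UI measure_bigcup//; last by move=> i _; exact: mI.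
    under eq_eseriesl do rewrite in_setT.
    apply: le_trans (nneseries_lim_ge n _) => //.
    rewrite big_map big_filter -sumEFin /index_iota subn0 big_mkcond/=; apply: lee_sum => i _.
    case: asboolP => Ii //.
    have [ij1 e1] := open_interval_finite_measure (oI _) (iI _) Ii (Ilty _).
    by rewrite [in leRHS]e1 lebesgue_measure_itv/= lte_fin ij1.
have [P1 P2 P3] := Pn.
apply: (@le_trans _ _ (\sum_(p <- s) (H p.2 - H p.1))%:E); last first.
  by rewrite lee_fin; exact: Hd.
rewrite big_map big_filter -sumEFin /index_iota subn0 [leRHS]big_mkcond/=; apply: lee_sum => i _.
case: asboolP => Ii; last by rewrite (In0 _ Ii) measure0.
have [ij1 e1] := open_interval_finite_measure (oI _) (iI _) Ii (Ilty _).
apply: (@le_trans _ _ (nu `](inf (I i)), (sup (I i))]%classic)).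
  apply: le_measure; rewrite ?inE//; first exact: mI.
  by rewrite [X in X `<=` _]e1; apply: subset_itvl; rewrite bnd_simp.
by rewrite -(stieltjes_measure_itv H)// ltW.
Unshelve. all: by end_near. Qed.

End monotone_decomposition.

(** * Densities and the fundamental theorem of calculus *)

Section absolute_continuity_ftc.
Context {R : realType}.
Implicit Types (a b u v : R) (F H : R -> R).
Local Notation mu := (@lebesgue_measure R).

Lemma ae_imp (P Q : R -> Prop) : (forall x, P x -> Q x) ->
  {ae mu, forall x, P x} -> {ae mu, forall x, Q x}.
Proof.
move=> PQ [A [mA A0 PA]]; exists A; split => //.
by apply: subset_trans PA => x nQ /PQ.
Qed.

Lemma ae_and (P Q : R -> Prop) : {ae mu, forall x, P x} -> {ae mu, forall x, Q x} ->
  {ae mu, forall x, P x /\ Q x}.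
Proof.
move=> [A [mA A0 PA]] [B [mB B0 QB]]; exists (A `|` B); split.
- exact: measurableU.
- exact: (etrans (measureU0 mA mB B0) A0).
- by move=> x /= /not_andP[nP|nQ]; [left; exact: PA|right; exact: QB].
Qed.

Lemma near_eq_derive1 F H (x : R) : (\near x, F x = H x) ->
  derivable F x 1 -> derivable H x 1 /\ derive1 H x = derive1 F x.
Proof.
move=> FH dF; split; first exact: (near_eq_derivable FH).
by rewrite !derive1E; apply: near_eq_derive; near do apply/esym; exact: FH.
Unshelve. all: by end_near. Qed.

Lemma derive1_add_cst F (c x : R) : derivable F x 1 ->
  derivable (fun y => F y + c) x 1 /\ derive1 (fun y => F y + c) x = derive1 F x.
Proof.
move=> dF; have dc := derivable_cst c x (1 : R); split; first exact: derivableD dF dc.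
by rewrite !derive1E (deriveD dF dc) derive_cst addr0.
Qed.

Lemma derive1_sub F H (x : R) : derivable F x 1 -> derivable H x 1 ->
  derivable (F \- H) x 1 /\ derive1 (F \- H) x = derive1 F x - derive1 H x.
Proof.
by move=> dF dH; split; [exact: derivableB|rewrite !derive1E (deriveB dF dH)].
Qed.

(** Radon-Nikodym gives the density h. That h is almost everywhere the derivative of H follows by
    differentiating the integral of h, which differs from H by a constant on ]a, b[. *)
Lemma nondecreasing_abs_continuous_density H a b : a < b -> {homo H : x y / x <= y} ->
  uniformly_abs_continuous H -> exists h : R -> R,
  [/\ mu.-integrable setT (EFin \o h),
      forall x y, a <= x -> x <= y -> y <= b -> (\int[mu]_(z in `]x, y]) (h z)%:E = (H y - H x)%:E)%E &
      {ae mu, forall x, x \in `]a, b[ -> derivable H x 1 /\ derive1 H x = h x}].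
Proof.
move=> ab ndH acH.
have rcH := uniformly_abs_continuous_right_continuous ndH acH.
pose cH := isCumulative.Build R _ R H ndH rcH.
pose Hc : cumulative R R := HB.pack H cH.
have dom := @stieltjes_null_dominates R Hc acH.
have mab : measurable (`]a, b]%classic : set (measurableTypeR R)) by exact: measurable_itv.
have ablty : (lebesgue_stieltjes_measure Hc `]a, b]%classic < +oo)%E.
  by rewrite stieltjes_measure_itv ?ltW// ltry.
(* Restriction to ]a, b] makes the Stieltjes measure finite, and a primitive taken from -oo then
   collects no mass to the left of [a]. *)
pose nu : {finite_measure set (measurableTypeR R) -> \bar R} := mfrestr mab ablty.
have domnu : nu `<< mu.
  apply/null_content_dominatesP => A mA A0.
  move/null_content_dominatesP : dom => /(_ _ mA A0) A0'.
  apply/eqP; rewrite eq_le measure_ge0 andbT -A0' /nu/= /mfrestr /mrestr.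
  by apply: le_measure; rewrite ?inE//; exact: measurableI.
have [f [f0 ffin fint fnu]] := radon_nikodym_sigma_finite domnu.
have fnuI (i : interval R) : nu [set` i] = (\int[mu]_(x in [set` i]) f x)%E.
  by apply: fnu; exact: measurable_itv.
pose h x := fine (f x).
have hf : EFin \o h = f by apply/funext => x; rewrite /= /h fineK.
have nuE x y : a <= x -> x <= y -> y <= b -> nu `]x, y]%classic = (H y - H x)%:E.
  move=> ax xy yb; rewrite /nu/= /mfrestr /mrestr setIidl.
    by rewrite stieltjes_measure_itv.
  by move=> z /=; rewrite !in_itv/= => /andP[xz zy]; lra.
have hH x y : a <= x -> x <= y -> y <= b ->
    (\int[mu]_(z in `]x, y]) (h z)%:E = (H y - H x)%:E)%E.
  by move=> ax xy yb; rewrite -nuE// fnu// -hf.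
exists h; split => //; first by rewrite hf.
have hint : mu.-integrable setT (EFin \o h) by rewrite hf.
pose F x := (\int[mu]_(t in `]-oo, x]) h t)%R.
have : {ae mu, forall x, derivable F x 1 /\ derive1 F x = h x}.
  apply: FTC1Ny; last exact: (open_integrable_locally openT hint).
  by move=> y; apply: integrableS hint.
apply: ae_imp.
move=> x /= [dF DF] xab.
have FE y : y \in `]a, b[ -> F y = H y - H a.
  rewrite in_itv/= => /andP[ay yb].
  rewrite /F /Rintegral -[RHS]/(fine (H y - H a)%:E) -(hH a y (lexx a) (ltW ay) (ltW yb)).
  congr (fine _).
  rewrite -[LHS]/(\int[mu]_(t in _) (EFin \o h) t)%E -[RHS]/(\int[mu]_(t in _) (EFin \o h) t)%E.
  rewrite hf -!fnuI.
  rewrite /nu/= /mfrestr /mrestr; congr (lebesgue_stieltjes_measure _ _).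
  by apply/seteqP; split => z /=; rewrite !in_itv/=; lra.
have FH : \near x, F x = H x - H a.
  by near=> y; apply: FE; near: y; exact: near_in_itvoo.
have [d1 D1] := near_eq_derive1 FH dF.
have [] := derive1_add_cst (H a) d1.
by under eq_fun do rewrite subrK; rewrite D1 DF.
Unshelve. all: by end_near. Qed.

(** Measurability of [derive1 F] is assumed because it agrees with the measurable [v - u] only
    almost everywhere, and Borel measurability does not pass across null sets. *)
Lemma abs_continuous_FTC2 F a b : a <= b -> abs_continuous_on a b F ->
  measurable_fun `]a, b[ (derive1 F) ->
  mu.-integrable `]a, b[ (EFin \o derive1 F) /\
  (\int[mu]_(z in `]a, b[) (derive1 F z)%:E = (F b - F a)%:E)%E.
Proof.
rewrite le_eqVlt => /predU1P[<- _ _|ab acF mF].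
  by rewrite set_itvoo0 integral_set0 subrr; split => //; exact: integrable_set0.
have [V [U [ndV ndU acV acU FVU]]] := abs_continuous_nondecreasing_decomposition (ltW ab) acF.
have [v [iv hv dv]] := nondecreasing_abs_continuous_density ab ndV acV.
have [u [iu hu du]] := nondecreasing_abs_continuous_density ab ndU acU.
have mab : measurable (`]a, b[%classic : set R) by exact: measurable_itv.
have ivab : mu.-integrable `]a, b[ (EFin \o v) by apply: integrableS iv.
have iuab : mu.-integrable `]a, b[ (EFin \o u) by apply: integrableS iu.
have ae : ae_eq mu (`]a, b[%classic : set R) (EFin \o (v \- u)) (EFin \o derive1 F).
  apply: ae_imp (ae_and dv du) => x /= [{}dv {}du]; move=> xab.
  have {dv}[dV DV] := dv xab; have {du}[dU DU] := du xab.
  have FH : \near x, (V \- U) x = F x.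
    near=> y; rewrite FVU//.
    have : y \in `]a, b[ by near: y; exact: near_in_itvoo.
    by rewrite in_itv/= => /andP[/ltW-> /ltW->].
  have [dVU DVU] := derive1_sub dV dU.
  by have [_ ->] := near_eq_derive1 FH dVU; rewrite DVU DV DU.
have ivu : mu.-integrable `]a, b[ (EFin \o (v \- u)).
  by apply: integrableB ivab iuab => //.
have /integrableP[mvu vuoo] := ivu.
have mF' : measurable_fun `]a, b[ (EFin \o derive1 F) by exact/measurable_EFinP.
split.
  apply/integrableP; split => //.
  rewrite (_ : (\int[mu]_(x in `]a, b[) `|(EFin \o derive1 F) x| = \int[mu]_(x in `]a, b[) `|(EFin \o (v \- u)%R) x|)%E)//.
  apply: ae_eq_integral => //.
  - exact: measurableT_comp.
  - exact: measurableT_comp.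
  - by apply: ae_imp ae => x /= h xab; have [<-] := h xab.
rewrite -(ae_eq_integral _ _ _ mvu mF' ae)//.
rewrite integralB_EFin//.
have oc (w W : R -> R) : measurable_fun `]a, b[ (EFin \o w) ->
    (forall x y : R, a <= x -> x <= y -> y <= b ->
      (\int[mu]_(z in `]x, y]) (w z)%:E)%E = (W y - W x)%:E) ->
    (\int[mu]_(z in `]a, b[) (w z)%:E)%E = (W b - W a)%:E.
  move=> mw hw; rewrite -(integral_itv_bndoo (f := EFin \o w) false false)// hw//.
  exact: ltW.
rewrite (oc _ _ (measurable_int _ ivab) hv) (oc _ _ (measurable_int _ iuab) hu) -EFinB.
congr (_%:E).
by rewrite !FVU ?lexx ?ltW//=; lra.
Unshelve. all: by end_near. Qed.

End absolute_continuity_ftc.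

(** * Averaged differences *)

Section affine_substitution.
Context {R : realType}.
Local Notation mu := (@lebesgue_measure R).

Lemma measurable_affine (c d : R) : measurable_fun setT (fun x : R => c * x + d).
Proof. by apply: measurable_funD => //; exact: mulrl_measurable. Qed.

Section affine.
Variables (c d : R).
Hypothesis c0 : c != 0.

Let T : measurableTypeR R -> measurableTypeR R := fun z => c * z + d.

Let mT : measurable_fun setT T.
Proof. exact: measurable_affine. Qed.

(** Uniqueness of Lebesgue measure reduces this to half-open intervals; for negative c the preimage
    is closed on the other side, with the same length. *)
Lemma lebesgue_measure_affine (A : set (measurableTypeR R)) : measurable A ->
  (`|c|%:E * mu ((fun z : R => (c * z + d)%R) @^-1` A) = mu A)%E.
Proof.
move=> mA; apply/esym.
pose m1 : {measure set (measurableTypeR R) -> \bar R} := pushforward mu T.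
pose m2 : {measure set (measurableTypeR R) -> \bar R} := mscale (NngNum (normr_ge0 c)) (m1 mT).
rewrite -[RHS]/(m2 A); apply: lebesgue_measure_unique => // _ [[a b]] _ <-.
rewrite /m2/= /mscale/= /pushforward.
have [c_gt0|c_lt0|/eqP] := ltgtP 0 c; last by rewrite eq_sym (negbTE c0).
  have -> : T @^-1` `]a, b] = `](a - d) / c, (b - d) / c]%classic.
    by apply/seteqP; split => z /=;
      rewrite /T !in_itv/= ltr_pdivrMr// ler_pdivlMr// => /andP[]; lra.
  rewrite !lebesgue_measure_itv/= !lte_fin ltr_pM2r ?invr_gt0// ltrD2r.
  case: ifPn => ab; last by rewrite mule0.
  by rewrite gtr0_norm// -EFinM; congr (_%:E); field; exact: lt0r_neq0.
have -> : T @^-1` `]a, b] = `[(b - d) / c, (a - d) / c[%classic.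
  by apply/seteqP; split => z /=;
    rewrite /T !in_itv/= ltr_ndivlMr// ler_ndivrMr// => /andP[]; lra.
rewrite !lebesgue_measure_itv/= !lte_fin ltr_nM2r ?invr_lt0// ltrD2r.
case: ifPn => ab; last by rewrite mule0.
by rewrite ltr0_norm// -EFinM; congr (_%:E); field; exact: ltr0_neq0.
Qed.

Lemma ge0_integral_affine (f : R -> \bar R) : measurable_fun setT f ->
  (forall x, (0 <= f x)%E) ->
  (\int[mu]_x f (c * x + d)%R = `|c|^-1%:E * \int[mu]_x f x)%E.
Proof.
move=> mf f0.
pose m1 : {measure set (measurableTypeR R) -> \bar R} := pushforward mu T.
have -> : (\int[mu]_x f x = \int[mscale (NngNum (normr_ge0 c)) (m1 mT)]_x f x)%E.
  by apply: eq_measure_integral => A mA _; exact: (esym (lebesgue_measure_affine mA)).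
rewrite ge0_integral_mscale//= muleA -EFinM mulVf ?mul1e ?normr_eq0//.
by rewrite (@ge0_integral_pushforward _ _ _ _ _ T mT mu setT f)// preimage_setT.
Qed.

End affine.

Lemma integral_shift (d : R) (f : R -> \bar R) : measurable_fun setT f ->
  (\int[mu]_x f (x + d)%R = \int[mu]_x f x)%E.
Proof.
move=> mf; rewrite integralE [RHS]integralE.
have sh g : measurable_fun setT g -> (forall x, 0 <= g x)%E ->
    (\int[mu]_x g (x + d)%R = \int[mu]_x g x)%E.
  move=> mg g0; rewrite -[RHS]mul1e -invr1 -(normr1 R) -(ge0_integral_affine d (oner_neq0 R) mg g0).
  by apply: eq_integral => x _; rewrite mul1r.
congr (_ - _)%E.
- rewrite -(sh _ (measurable_funepos mf) (funepos_ge0 f)); apply: eq_integral => x _.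
  by rewrite -[LHS]/((f \o (fun y => y + d)%R)^\+ x)%E funepos_comp.
- rewrite -(sh _ (measurable_funeneg mf) (funeneg_ge0 f)); apply: eq_integral => x _.
  by rewrite -[LHS]/((f \o (fun y => y + d)%R)^\- x)%E funeneg_comp.
Qed.

End affine_substitution.

Section forward_differences.
Context {R : realType}.
Implicit Types (F : R -> R) (s v h x z : R) (n : nat).

(** The recursion serves inductions; [fdiff_sum] recovers the binomial sum of [sym_diff]. *)
Fixpoint fdiff n s F x : R :=
  if n is n'.+1 then fdiff n' s F (x + s) - fdiff n' s F x else F x.

Lemma fdiffSr n s F x : fdiff n.+1 s F x = fdiff n s (fun y => F (y + s) - F y) x.
Proof. by elim: n x => [//|n ih] x; rewrite [RHS]/= -!ih. Qed.

Lemma fdiff_lin n s (c : R) F H x :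
  fdiff n s (fun y => F y + c * H y) x = fdiff n s F x + c * fdiff n s H x.
Proof. by elim: n x => [//|n ih] x; rewrite /= !ih; ring. Qed.

Lemma fdiff_shift n s d F x : fdiff n s (fun y => F (y + d)) x = fdiff n s F (x + d).
Proof. by elim: n x => [//|n ih] x /=; rewrite !ih addrAC. Qed.

Lemma fdiff_sum n s F x : fdiff n s F x =
  \sum_(i < n.+1) 'C(n, i)%:R * (-1) ^+ (n - i) * F (x + i%:R * s).
Proof.
elim: n x => [|n ih] x; first by rewrite big_ord1 /= bin0 expr0 !mul1r mul0r addr0.
rewrite /= !ih [RHS]big_ord_recl /= bin0 subn0 mul0r addr0 mul1r.
rewrite [X in _ - X]big_ord_recl /= bin0 subn0 mul0r addr0 mul1r.
under [X in _ = _ + X]eq_bigr do rewrite /bump/= add1n binS natrD mulrDl mulrDl subSS.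
rewrite big_split /=.
rewrite [X in _ = _ + (X + _)]big_ord_recr /= bin_small// !mul0r addr0 exprS.
have -> : \sum_(i < n) 'C(n, i.+1)%:R * (-1) ^+ (n - i) * F (x + i.+1%:R * s) =
  - \sum_(i < n) 'C(n, bump 0 i)%:R * (-1) ^+ (n - bump 0 i) * F (x + (bump 0 i)%:R * s).
  rewrite -sumrN; apply: eq_bigr => i _; rewrite /bump/= add1n.
  have -> : (n - i = (n - i.+1).+1)%N by have := ltn_ord i; lia.
  by rewrite exprS; ring.
have e (i : nat) : x + s + i%:R * s = x + i.+1%:R * s by rewrite -natr1; ring.
under eq_bigr do rewrite e.
by ring.
Qed.

Lemma fdiff0 n F x : (0 < n)%N -> fdiff n 0 F x = 0.
Proof. by case: n => // n _ /=; rewrite addr0 subrr. Qed.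

Lemma fdiff_rev n s F x :
  \sum_(j < n.+1) (-1) ^+ j * 'C(n, j)%:R * F (x - j%:R * s) = fdiff n s F (x - n%:R * s).
Proof.
rewrite fdiff_sum (reindex_inj rev_ord_inj)/=; apply: eq_bigr => i _.
have i_n := ltn_ord i.
rewrite subSS bin_sub ?[_ * 'C(_, _)%:R]mulrC//; congr (_ * F _).
by rewrite natrB //; ring.
Qed.

(* The points [x + i (h - j v)] are summed with weights
   [(-1)^(i+j) C(n,i) C(n,j)] first along [i], then along [j]. *)
Lemma fdiff_exchange n h v F x :
  \sum_(j < n.+1) (-1) ^+ j * 'C(n, j)%:R * fdiff n (h - j%:R * v) F x =
  \sum_(i < n.+1) 'C(n, i)%:R * (-1) ^+ (n - i) * fdiff n (i%:R * v) F (x + i%:R * (h - n%:R * v)).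
Proof.
under eq_bigr do rewrite fdiff_sum mulr_sumr.
rewrite exchange_big/=; apply: eq_bigr => i _.
have -> : x + i%:R * (h - n%:R * v) = (x + i%:R * h) - n%:R * (i%:R * v) by ring.
rewrite -fdiff_rev mulr_sumr; apply: eq_bigr => j _.
rewrite mulrCA; congr (_ * (_ * _)).
by congr (F _); ring.
Qed.

(** In [fdiff_exchange] the term j = 0 is the difference of step h itself, and the term i = 0
    vanishes since its step is 0. *)
Lemma fdiff_exchange_le n h v F x (A B : nat -> R) : (0 < n)%N ->
  (forall i, (0 < i <= n)%N -> `|fdiff n (i%:R * v) F (x + i%:R * (h - n%:R * v))| <= A i) ->
  (forall j, (0 < j <= n)%N -> `|fdiff n (h - j%:R * v) F x| <= B j) ->
  `|fdiff n h F x| <= \sum_(i < n) 'C(n, i.+1)%:R * (A i.+1 + B i.+1).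
Proof.
move=> n0 hA hB; have := fdiff_exchange n h v F x.
rewrite !big_ord_recl/= !mul0r subr0 addr0 fdiff0// mulr0 add0r bin0 expr0 !mul1r.
set S := \sum_(_ < _) _; set T := \sum_(_ < _) _ => ST.
have -> : fdiff n h F x = T - S by rewrite -ST; ring.
apply: (le_trans (ler_normB _ _)).
have nC i : `|'C(n, i)%:R : R| = 'C(n, i)%:R by rewrite ger0_norm.
have n1 i : `|(-1) ^+ i : R| = 1 by rewrite normrX normrN1 expr1n.
under [leRHS]eq_bigr do rewrite mulrDr.
rewrite big_split/=; apply: lerD; apply: (le_trans (ler_norm_sum _ _ _));
  apply: ler_sum => i _; rewrite /bump/= add1n !normrM nC n1 ?mulr1 ?mul1r ler_wpM2l//.
- by apply: hA; rewrite /= ltn_ord.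
- by apply: hB; rewrite /= ltn_ord.
Qed.

(** An increment over m h telescopes into m increments over h; iterating this n times produces m^n
    differences of step h with base points in [z, z + n (m - 1) h]. *)
Lemma fdiff_subdivision_le n m h F z (B : R) : 0 <= h -> (0 < m)%N ->
  (forall w, z <= w -> w <= z + n%:R * (m.-1%:R * h) -> `|fdiff n h F w| <= B) ->
  `|fdiff n (m%:R * h) F z| <= m%:R ^+ n * B.
Proof.
move=> h0 m0; elim: n F B z => [|n ih] F B z hB.
  by rewrite expr0 mul1r; apply: hB => //; rewrite mul0r addr0.
rewrite fdiffSr exprSr -mulrA; apply: ih => w zw wz.
have tele j y : F (y + j%:R * h) - F y = \sum_(i < j) (F (y + i%:R * h + h) - F (y + i%:R * h)).
  elim: j => [|j ihj]; first by rewrite big_ord0 mul0r addr0 subrr.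
  rewrite big_ord_recr/= -ihj -natr1 mulrDl mul1r addrA; ring.
under eq_fun do rewrite tele.
have -> : fdiff n h (fun y => \sum_(i < m) (F (y + i%:R * h + h) - F (y + i%:R * h))) w =
  \sum_(i < m) fdiff n.+1 h F (w + i%:R * h).
  elim: m {m0 hB wz} => [|m ihm].
    under eq_fun do rewrite big_ord0.
    rewrite big_ord0 fdiff_sum big1// => i _; exact: mulr0.
  under eq_fun do rewrite big_ord_recr/= -[X in _ + X]mul1r.
  rewrite fdiff_lin mul1r ihm big_ord_recr/=; congr (_ + _).
  by rewrite [RHS](fdiffSr n); exact: (fdiff_shift n h (m%:R * h) (fun y => F (y + h) - F y)).
apply: (le_trans (ler_norm_sum _ _ _)).
have -> : m%:R * B = \sum_(i < m) B by rewrite sumr_const card_ord mulr_natl.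
apply: ler_sum => i _; apply: hB.
  by apply: (le_trans zw); rewrite lerDl mulr_ge0.
have : i%:R * h <= m.-1%:R * h.
  by rewrite ler_wpM2r// ler_nat; have := ltn_ord i; lia.
rewrite -(natr1 n) mulrDl mul1r; lra.
Qed.

End forward_differences.

(** * Integral bounds for differences of a primitive *)

Section difference_estimates.
Context {R : realType}.
Local Notation mu := (@lebesgue_measure R).

Lemma integrable_shift_itv (f : R -> R) (d x y : R) : measurable_fun setT f ->
  mu.-integrable `](x + d)%R, (y + d)%R[ (EFin \o f) ->
  mu.-integrable `]x, y[ (EFin \o (fun u => f (u + d))) /\
  (\int[mu]_(u in `]x, y[) (f (u + d))%:E = \int[mu]_(u in `](x + d)%R, (y + d)%R[) (f u)%:E)%E.
Proof.
move=> mf /integrableP[_ foo].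
have mfd : measurable_fun setT (fun u : R => f (u + d)).
  by apply: measurableT_comp => //; exact: measurable_funD.
have key (p : R -> \bar R) : measurable_fun setT p ->
    (\int[mu]_(u in `]x, y[) p (u + d)%R = \int[mu]_(u in `](x + d)%R, (y + d)%R[) p u)%E.
  move=> mp; rewrite integral_mkcond [RHS]integral_mkcond.
  rewrite -(@integral_shift _ d (p \_ `](x + d)%R, (y + d)%R[)); last first.
    apply/(measurable_restrictT _ _).1 => //; exact: measurable_funTS.
  apply: eq_integral => u _; rewrite !patchE; congr (if _ then _ else _).
  by apply/idP/idP; rewrite !inE/= !in_itv/=; lra.
split; last by rewrite -(key (EFin \o f))//; exact/measurable_EFinP.
apply/integrableP; split; first exact/measurable_EFinP/measurable_funTS.
rewrite (_ : (\int[mu]_(u in _) _ = \int[mu]_(u in `](x + d)%R, (y + d)%R[) `|(f u)%:E|)%E)//.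
rewrite -(key (fun u => `|(f u)%:E|%E))//.
by apply: measurableT_comp => //; exact/measurable_EFinP.
Qed.

Lemma measurable_fdiff n s (G : R -> R) : measurable_fun setT G ->
  measurable_fun setT (fdiff n s G).
Proof.
move=> mG; elim: n => [//|n ih]; apply: measurable_funB => //.
by apply: measurableT_comp => //; exact: measurable_funD.
Qed.

Section primitive.
Variables (g G : R -> R) (a b : R).
Hypothesis mG : measurable_fun setT G.
Hypothesis gG : forall x y, a <= x -> x <= y -> y <= b ->
  mu.-integrable `]x, y[ (EFin \o G) /\
  (\int[mu]_(u in `]x, y[) (G u)%:E = (g y - g x)%:E)%E.

(** Differencing commutes with taking primitives; every further difference shifts the interval by s,
    so room n s must remain before b. *)
Lemma integral_fdiff n s x y : 0 <= s -> a <= x -> x <= y -> y + n%:R * s <= b ->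
  mu.-integrable `]x, y[ (EFin \o fdiff n s G) /\
  (\int[mu]_(u in `]x, y[) (fdiff n s G u)%:E = (fdiff n s g y - fdiff n s g x)%:E)%E.
Proof.
move=> s0; elim: n x y => [|n ih] x y ax xy yb.
  by apply: gG => //; move: yb; rewrite mul0r addr0.
have yb' : y + s + n%:R * s <= b by move: yb; rewrite -natr1; lra.
have ns : 0 <= n%:R * s by rewrite mulr_ge0.
have [|i1 e1] := ih x y ax xy; first lra.
have [| |i2 e2] := ih (x + s) (y + s) _ _ yb'; [lra|lra|].
have [i3 e3] := integrable_shift_itv (measurable_fdiff n s mG) i2.
split; first by apply: (integrableB _ i3 i1) => //; exact: measurable_itv.
rewrite /= integralB_EFin//.
by rewrite e3 e2 e1 -EFinB; congr (_%:E); ring.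
Qed.

(** Centring at y matches [sym_diff]; the value 0 for stencils that leave ]a, b[ lets the integrals
    run over the whole line. *)
Definition centered_diff k (s y : R) : R :=
  if (a + k%:R * s / 2 < y) && (y < b - k%:R * s / 2)
  then `|fdiff k s G (y - k%:R * s / 2)| else 0.

Definition diff_mass k (s : R) : \bar R := (\int[mu]_y (centered_diff k s y)%:E)%E.

Lemma centered_diff_ge0 k s y : 0 <= centered_diff k s y.
Proof. by rewrite /centered_diff; case: ifP. Qed.

Lemma measurable_centered_fdiff k :
  measurable_fun setT (fun p : R * R => `|fdiff k p.1 G (p.2 - k%:R * p.1 / 2)|).
Proof.
have m1 : measurable_fun setT (fun p : R * R => k%:R * p.1 / 2).
  by apply: measurable_funM => //; apply: measurable_funM.
apply: measurableT_comp => //.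
rewrite (_ : (fun p : R * R => _) = fun p : R * R => \sum_(i < k.+1)
  'C(k, i)%:R * (-1) ^+ (k - i) * G (p.2 - k%:R * p.1 / 2 + i%:R * p.1)); last first.
  by apply/funext => p; rewrite fdiff_sum.
apply: measurable_sum => i; apply: measurable_funM => //.
apply: measurableT_comp => //; apply: measurable_funD; last exact: measurable_funM.
exact: measurable_funB.
Qed.

Lemma measurable_centered_diff k :
  measurable_fun setT (fun p : R * R => centered_diff k p.1 p.2).
Proof.
have m1 : measurable_fun setT (fun p : R * R => k%:R * p.1 / 2).
  by apply: measurable_funM => //; apply: measurable_funM.
apply: measurable_fun_ifT => //; last exact: measurable_centered_fdiff.
apply: measurable_and; apply: measurable_fun_ltr => //; first exact: measurable_funD.
exact: measurable_funB.
Qed.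

Lemma diff_massE k s : diff_mass k s =
  (\int[mu]_(u in `]a, (b - k%:R * s)%R[) `|(fdiff k s G u)%:E|)%E.
Proof.
rewrite /diff_mass -(integral_shift (k%:R * s / 2)); last first.
  apply/measurable_EFinP.
  exact: (measurableT_comp (measurable_centered_diff k) (measurable_pair1 s)).
rewrite [RHS]integral_mkcond; apply: eq_integral => u _.
rewrite patchE /centered_diff addrK.
rewrite -(_ : (u \in `]a, (b - k%:R * s)%R[%classic) = (a + k%:R * s / 2 < u + k%:R * s / 2)
   && (u + k%:R * s / 2 < b - k%:R * s / 2)); first by case: ifP.
by apply/idP/idP; rewrite !inE/= in_itv/=; lra.
Qed.

Lemma diff_mass_fin k s : 0 <= s -> a + k%:R * s <= b -> diff_mass k s \is a fin_num.
Proof.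
move=> s0 ab; rewrite diff_massE ge0_fin_numE; last exact: integral_ge0.
have abk : a <= b - k%:R * s by lra.
have bb : b - k%:R * s + k%:R * s <= b by rewrite subrK.
by have [/integrableP[]] := integral_fdiff s0 (lexx a) abk bb.
Qed.

Lemma diff_mass_ge0 k s : (0 <= diff_mass k s)%E.
Proof. by apply: integral_ge0 => y _; rewrite lee_fin centered_diff_ge0. Qed.

(** One of the k + 1 differences of g becomes the integral of [fdiff k s G] over [z, z + s], which
    is part of the range of [diff_mass]. *)
Lemma fdiff_le_diff_mass k s z : 0 <= s -> a <= z -> z + k.+1%:R * s <= b ->
  (`|fdiff k.+1 s g z|%:E <= diff_mass k s)%E.
Proof.
move=> s0 az zb; have zb' : z + s + k%:R * s <= b by move: zb; rewrite -natr1; lra.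
have zs : z <= z + s by lra.
have [i1 e1] := integral_fdiff s0 az zs zb'.
rewrite diff_massE -[X in (X <= _)%E]/(`|(fdiff k s g (z + s) - fdiff k s g z)%:E|%E) -e1.
apply: (le_trans (le_abse_integral _ _ _)).
- exact: measurable_itv.
- by case/integrableP: i1.
- apply: ge0_subset_integral => //.
  + apply: measurable_funTS; apply: measurableT_comp => //.
    by apply/measurable_EFinP; exact: measurable_fdiff.
  + by move=> u /=; rewrite !in_itv/=; lra.
Qed.

End primitive.
End difference_estimates.

Section difference_average.
Context {R : realType}.
Local Notation mu := (@lebesgue_measure R).

(** Substitution s = c v + d; its Jacobian 1 / |c| <= 1 is discarded. *)
Lemma ge0_le_integral_affine (H : R -> \bar R) (c d x y x' y' : R) :
  measurable_fun setT H -> (forall s, (0 <= H s)%E) -> 1 <= `|c| ->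
  (forall v, x <= v <= y -> x' <= c * v + d <= y') ->
  (\int[mu]_(v in `[x, y]) H (c * v + d)%R <= \int[mu]_(s in `[x', y']) H s)%E.
Proof.
move=> mH H0 c1 xy; rewrite integral_mkcond [leRHS]integral_mkcond.
have c0 : c != 0 by rewrite -normr_gt0; apply: lt_le_trans c1.
have mHE : measurable_fun setT (H \_ `[x', y']).
  by apply/(measurable_restrictT _ _).1 => //; exact: measurable_funTS.
have HE0 s : (0 <= (H \_ `[x', y']) s)%E by rewrite patchE; case: ifP.
have mHc : measurable_fun setT (fun v : R => H (c * v + d)).
  by apply: measurableT_comp => //; exact: measurable_affine.
apply: (@le_trans _ _ (\int[mu]_v (H \_ `[x', y']) (c * v + d)%R)%E).
  apply: ge0_le_integral => //.
  - by move=> v _; rewrite patchE; case: ifP.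
  - by apply/(measurable_restrictT _ _).1 => //; exact: measurable_funTS.
  - by apply: measurableT_comp => //; exact: measurable_affine.
  - move=> v _; rewrite !patchE; case: ifP => [|_]; last by case: ifP.
    rewrite inE/= in_itv/= => /xy vE; case: ifPn => //.
    by rewrite notin_setE/= in_itv/= vE.
rewrite ge0_integral_affine// -[leRHS]mul1e lee_wpmul2r//; first exact: integral_ge0.
by rewrite lee_fin invf_le1// (lt_le_trans ltr01).
Qed.

Variables (g G : R -> R) (a b : R).
Hypothesis mG : measurable_fun setT G.
Hypothesis gG : forall x y, a <= x -> x <= y -> y <= b ->
  mu.-integrable `]x, y[ (EFin \o G) /\
  (\int[mu]_(u in `]x, y[) (G u)%:E = (g y - g x)%:E)%E.

Lemma measurable_diff_mass k : measurable_fun setT (diff_mass G a b k).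
Proof.
apply: (@measurable_fun_fubini_tonelli_F _ _ _ _ R mu
  (fun p => (centered_diff G a b k p.1 p.2)%:E)) => //.
  by apply/measurable_EFinP; exact: measurable_centered_diff.
by move=> p; rewrite lee_fin centered_diff_ge0.
Qed.

(** For v in [v0, 2 v0] and 1 <= i <= N the steps i v and h - i v lie in [v0, h], because h = 4 N v0
    gives N v <= h / 2. Integrating over v, an interval of length v0, gives the factor v0 on the
    left. In the constant, m^N counts the subdivided differences, 2^N bounds the sum of the
    binomials, and the last 2 accounts for the two families of steps. *)
Lemma fdiff_average_le k m (v0 : R) : 0 < v0 -> (0 < m)%N ->
  a + k.+1%:R * (m%:R * (4 * k.+1%:R * v0)) <= b ->
  ((v0 * `|fdiff k.+1 (m%:R * (4 * k.+1%:R * v0)) g a|)%:E <=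
   (2 * (2 * m%:R) ^+ k.+1)%:E *
     \int[mu]_(s in `[v0, (4 * k.+1%:R * v0)%R]) diff_mass G a b k s)%E.
Proof.
move=> v00 m0; set N := k.+1; set h := 4 * N%:R * v0 => ab.
set H := diff_mass G a b k; set I := (\int[mu]_(s in _) H s)%E.
have N1 : 1 <= N%:R :> R by rewrite ler1n.
have h0 : 0 <= h by rewrite /h; nra.
have m1 : 1 <= m%:R :> R by rewrite ler1n.
have mE : m%:R = m.-1%:R + 1 :> R by rewrite natr1 prednK.
have ab' w : w <= a + N%:R * (m.-1%:R * h) -> w + N%:R * h <= b.
  by move=> wz; move: ab; rewrite mE; nra.
have mh0 : 0 <= m.-1%:R * h by apply: mulr_ge0.
have Nh : N%:R * h <= b - a.
  have : a + N%:R * h <= b by apply: ab'; rewrite lerDl; apply: mulr_ge0.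
  lra.
have iv (i : nat) (v : R) : (i <= N)%N -> v0 <= v <= 2 * v0 -> i%:R * v <= h / 2.
  move=> iN /andP[v1 v2]; have : i%:R <= N%:R :> R by rewrite ler_nat.
  by rewrite /h => ?; have := ler0n R i; nra.
have Hfin s : 0 <= s -> s <= h -> H s \is a fin_num.
  move=> s0 sh; apply: (diff_mass_fin mG gG) => //.
  have : k%:R * s <= N%:R * h by apply: ler_pM => //; rewrite ler_nat.
  by move=> ks; rewrite -lerBrDl; apply: le_trans Nh.
have P v : v0 <= v <= 2 * v0 -> `|fdiff N (m%:R * h) g a| <= m%:R ^+ N *
    \sum_(i < N) 'C(N, i.+1)%:R * (fine (H (i.+1%:R * v)) + fine (H (h - i.+1%:R * v))).
  move=> vv; have [v1 v2] := andP vv.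
  apply: fdiff_subdivision_le => // w zw wz.
  apply: (@fdiff_exchange_le _ _ _ v _ _ (fun i => fine (H (i%:R * v)))
    (fun i => fine (H (h - i%:R * v)))) => // i /andP[i0 iN];
    have ivi := iv _ _ iN vv; have ivN := iv _ _ (leqnn N) vv;
    have iv0 : 0 <= i%:R * v by rewrite mulr_ge0//; lra.
  - rewrite -lee_fin fineK; last by apply: Hfin => //; lra.
    apply: (fdiff_le_diff_mass mG gG) => //.
    + by apply: (le_trans zw); rewrite lerDl mulr_ge0//; lra.
    + apply: le_trans (ab' _ wz).
      rewrite -addrA lerD2l.
      have -> : i%:R * (h - N%:R * v) + k.+1%:R * (i%:R * v) = i%:R * h by rewrite /N; ring.
      by rewrite ler_wpM2r// ler_nat.
  - rewrite -lee_fin fineK; last by apply: Hfin => //; lra.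
    apply: (fdiff_le_diff_mass mG gG) => //; first lra.
    apply: le_trans (ab' _ wz); rewrite lerD2l ler_wpM2l//; lra.
have mH : measurable_fun setT H by exact: measurable_diff_mass.
have H0 s : (0 <= H s)%E by exact: diff_mass_ge0.
have I0 : (0 <= I)%E by exact: integral_ge0.
have mHa c d : measurable_fun setT (fun v : R => H (c * v + d)).
  by apply: measurableT_comp => //; exact: measurable_affine.
have e1 (i : nat) v : i%:R * v = i%:R * v + 0 by rewrite addr0.
have e2 (i : nat) v : h - i%:R * v = - i%:R * v + h by ring.
have PE v : v0 <= v <= 2 * v0 -> (`|fdiff N (m%:R * h) g a|%:E <= (m%:R ^+ N)%:E *
    \sum_(i < N) 'C(N, i.+1)%:R%:E * (H (i.+1%:R * v + 0)%R + H (- i.+1%:R * v + h)%R))%E.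
  move=> vv; have := P _ vv; rewrite -lee_fin EFinM -sumEFin.
  have [v1 v2] := andP vv.
  under eq_bigr => i _.
    have ivi := iv i.+1 _ (ltn_ord i) vv.
    have iv0 : 0 <= i.+1%:R * v by rewrite mulr_ge0//; lra.
    rewrite EFinM EFinD !fineK ?Hfin//; [|lra..].
    rewrite [in X in (_ * (X + _))%E]e1 e2.
    over.
  by [].
have -> : ((v0 * `|fdiff N (m%:R * h) g a|)%:E =
    \int[mu]_(v in `[v0, (2 * v0)%R]) `|fdiff N (m%:R * h) g a|%:E)%E.
  rewrite integral_cst//= lebesgue_measure_itv/= lte_fin.
  have -> : v0 < 2 * v0 by lra.
  by rewrite -EFinB -EFinM; congr (_%:E); ring.
have mS (i : nat) : measurable_fun setT (fun v : R =>
    ('C(N, i.+1)%:R%:E * (H (i.+1%:R * v + 0)%R + H (- i.+1%:R * v + h)%R))%E).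
  by apply: emeasurable_funM => //; apply: emeasurable_funD.
have S0 (i : nat) (v : R) : (0 <= 'C(N, i.+1)%:R%:E * (H (i.+1%:R * v + 0)%R + H (- i.+1%:R * v + h)%R))%E.
  by rewrite mule_ge0// adde_ge0.
apply: (@le_trans _ _ (\int[mu]_(v in `[v0, (2 * v0)%R]) ((m%:R ^+ N)%:E *
    \sum_(i < N) 'C(N, i.+1)%:R%:E * (H (i.+1%:R * v + 0)%R + H (- i.+1%:R * v + h)%R)))%E).
  apply: ge0_le_integral => //.
  - apply: measurable_funTS; apply: emeasurable_funM => //.
    by apply: emeasurable_sum => i _; exact: mS.
rewrite ge0_integralZl_EFin//; last 2 first.
- by move=> v _; apply: sume_ge0.
- by apply: measurable_funTS; apply: emeasurable_sum => i _; exact: mS.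
rewrite ge0_integral_sum//; last by move=> i; apply: measurable_funTS; exact: mS.
apply: (@le_trans _ _ ((m%:R ^+ N)%:E * \sum_(i < N) ('C(N, i.+1)%:R * 2)%:E * I)%E).
  apply: lee_wpmul2l; first by rewrite lee_fin exprn_ge0.
  apply: lee_sum => i _.
  have iN := ltn_ord i.
  rewrite ge0_integralZl_EFin//; [|by move=> v _; exact: adde_ge0|
    by apply: measurable_funTS; apply: emeasurable_funD; exact: mHa].
  rewrite EFinM -muleA lee_wpmul2l ?lee_fin//.
  rewrite ge0_integralD//; [|by apply: measurable_funTS; exact: mHa..].
  rewrite (_ : 2%:E * I = I + I)%E; last by rewrite mule_natl mule2n.
  apply: leeD; apply: ge0_le_integral_affine => //.
  - by rewrite ger0_norm// ler1n.
  - move=> v vv; have := iv i.+1 v iN vv; rewrite addr0.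
    have : 1 <= i.+1%:R :> R by rewrite ler1n.
    by move: vv => /andP[v1 v2] i1 ih; apply/andP; split; [nra|lra].
  - by rewrite normrN ger0_norm// ler1n.
  - move=> v vv; have := iv i.+1 v iN vv.
    have : 1 <= i.+1%:R :> R by rewrite ler1n.
    move: vv => /andP[v1 v2] i1 ih.
    have : v0 <= h / 2 by rewrite /h; nra.
    by move=> ?; apply/andP; split; [lra|nra].
rewrite -ge0_sume_distrl; last by move=> i _; rewrite lee_fin mulr_ge0.
rewrite muleA lee_wpmul2r// sumEFin -EFinM lee_fin -mulr_suml exprMn.
have : \sum_(i < N) 'C(N, i.+1)%:R <= 2 ^+ N :> R.
  have -> : 2 ^+ N = \sum_(i < N.+1) 'C(N, i)%:R :> R.
    rewrite (_ : 2 = 1 + 1 :> R)// exprDn; apply: eq_bigr => i _.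
    by rewrite !expr1n mul1r.
  by rewrite [leRHS]big_ord_recl lerDr.
have : 0 <= m%:R ^+ N :> R by rewrite exprn_ge0.
by set x := m%:R ^+ N; set y := 2 ^+ N; set z := \sum_(_ < _) _; nra.
Qed.

End difference_average.

(** * The kernel and its marginals *)

Section geometry.
Context {R : realType}.
Implicit Types (x y s h : R).

Lemma phi_ge0 x : 0 <= phi x.
Proof. exact: sqrtr_ge0. Qed.

Lemma phiN x : phi (- x) = phi x.
Proof. by rewrite /phi sqrrN. Qed.

Lemma phi_sqr x : -1 <= x <= 1 -> phi x ^+ 2 = (1 - x) * (1 + x).
Proof. by move=> xb; rewrite sqr_sqrtr; [ring|nra]. Qed.

Lemma phi_gt0 x : -1 < x < 1 -> 0 < phi x.
Proof. by move=> xb; rewrite sqrtr_gt0; nra. Qed.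

(* On [x + delta phi(x) / 2 < 1] one has [delta x <= phi x], so the slope of
   [x + delta phi(x) / 2] is at least 1/2 there. *)
Lemma right_endpoint_expansion (d x1 x2 : R) : 0 < d -> -1 < x1 -> x1 <= x2 ->
  x1 + d * phi x1 / 2 < 1 -> x2 + d * phi x2 / 2 < 1 ->
  x2 - x1 <= 2 * ((x2 + d * phi x2 / 2) - (x1 + d * phi x1 / 2)).
Proof.
move=> d0 x1m x12 p1 p2.
have x1b : -1 < x1 < 1 by have := phi_ge0 x1; nra.
have x2b : -1 < x2 < 1 by have := phi_ge0 x2; nra.
have := phi_gt0 x1b; have := phi_gt0 x2b.
have : phi x1 ^+ 2 = (1 - x1) * (1 + x1) by apply: phi_sqr; lra.
have : phi x2 ^+ 2 = (1 - x2) * (1 + x2) by apply: phi_sqr; lra.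
set f1 := phi x1 in p1 *; set f2 := phi x2 in p2 * => e2 e1 f20 f10.
have slope x f : -1 < x < 1 -> 0 < f -> f ^+ 2 = (1 - x) * (1 + x) -> x + d * f / 2 < 1 ->
    d * x <= f.
  move=> xb f0 ef pf; case: (leP x 0) => [x0|x0]; first nra.
  rewrite -(ler_pM2r f0) -expr2 ef.
  have : d * f < 2 * (1 - x) by lra.
  nra.
have s1 := slope _ _ x1b f10 e1 p1; have s2 := slope _ _ x2b f20 e2 p2.
have : (f2 - f1) * (f1 + f2) = (x1 - x2) * (x1 + x2).
  have -> : (f2 - f1) * (f1 + f2) = f2 ^+ 2 - f1 ^+ 2 by ring.
  by rewrite e1 e2; ring.
have f120 : 0 < f1 + f2 by lra.
move=> e.
suff : - (x2 - x1) <= d * (f2 - f1) by lra.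
rewrite -(ler_pM2r f120) -mulrA e; nra.
Qed.

Section admissible.
Variables (k : nat) (h : R).
Hypotheses (k0 : (0 < k)%N) (h0 : 0 < h).
Let N : R := k.+1%:R.
(* 16 K + 1 is large enough for [s <= h phi(y)] at every admissible [x, s, y]. *)
Definition subdivisions : nat := (16 * k.+1 + 1)%N.
Let m : R := subdivisions%:R.

(** The stencil of centre y and step s lies inside the large stencil I of centre x, itself inside
    (-1, 1). The range of s is the interval [v0, 4 N v0] of [fdiff_average_le], with m (4 N v0) = h
    phi(x). *)
Definition admissible x s y : bool :=
  [&& -1 < x - N * (h * phi x) / 2, x + N * (h * phi x) / 2 < 1,
     h * phi x <= 4 * N * m * s, m * s <= h * phi x,
     x - N * (h * phi x) / 2 + k%:R * s / 2 < y &
     y < x + N * (h * phi x) / 2 - k%:R * s / 2].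

Let N2 : 2 <= N. Proof. by rewrite /N ler_nat. Qed.
Let k1 : 1 <= k%:R :> R. Proof. by rewrite ler1n. Qed.
Let Nk : N = k%:R + 1. Proof. by rewrite /N natr1. Qed.
Let mE : m = 16 * N + 1. Proof. by rewrite /m /subdivisions natrD natrM. Qed.

Let m0 : 0 < m.
Proof. by rewrite mE; have := N2; lra. Qed.

Let N0 : 0 < N.
Proof. by have := N2; lra. Qed.

Let m_sqr : 2 * (1 + 8 * N * m) <= m ^+ 2.
Proof. by rewrite expr2 {3}mE; have := m0; have := N2; rewrite mE; nra. Qed.

Lemma admissible_bounds x s y : admissible x s y ->
  [/\ -1 < x < 1, 0 < s, -1 < y - k%:R * s / 2, y + k%:R * s / 2 < 1 & -1 < y < 1].
Proof.
case/and5P => a1 a2 a3 a4 /andP[a5 a6].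
have Nhp : 0 <= N * (h * phi x) by rewrite mulr_ge0// mulr_ge0 ?phi_ge0// ltW.
have xb : -1 < x < 1 by lra.
have hp : 0 < h * phi x by rewrite mulr_gt0// phi_gt0.
have Nm0 : 0 < 4 * N * m by rewrite !mulr_gt0.
have s0 : 0 < s by rewrite -(pmulr_rgt0 s Nm0); lra.
have ks : 0 <= k%:R * s by rewrite mulr_ge0// ltW.
by split => //; lra.
Qed.

(** The distance of y to either endpoint of [-1, 1] is at least k s / 2, and half the length of I is
    at most 8 N m times any such distance. Passing from y to x thus enlarges the distance to the
    nearer endpoint at most by 1 + 8 N m. The distance of x to the other endpoint is at most 2, and
    [m_sqr] absorbs both factors. *)
Lemma admissible_phi_le x s y : admissible x s y -> phi x <= m * phi y.
Proof.
move=> adm; have [xb s0 y1 y2 yb] := admissible_bounds adm.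
case/and5P: adm => a1 a2 a3 a4 /andP[a5 a6].
have fx0 := phi_gt0 xb; have fy0 := phi_gt0 yb.
have ex : phi x ^+ 2 = (1 - x) * (1 + x) by apply: phi_sqr; lra.
have ey : phi y ^+ 2 = (1 - y) * (1 + y) by apply: phi_sqr; lra.
have D1 (w : R) : k%:R * s / 2 <= w -> N * (h * phi x) / 2 <= 8 * N * m * w.
  move=> sw; have Ns : N * s <= 4 * w.
    by have : 0 <= (k%:R - 1) * s; [rewrite mulr_ge0 ?subr_ge0// ltW|rewrite Nk; lra].
  have : N * (h * phi x) <= N * (4 * N * m * s) by rewrite ler_pM2l.
  have : (4 * N * m) * (N * s) <= (4 * N * m) * (4 * w) by rewrite ler_wpM2l// !mulr_ge0// ltW.
  lra.
have Dp := D1 (1 - y) ltac:(lra); have Dm := D1 (1 + y) ltac:(lra).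
have ks : 0 <= k%:R * s by rewrite mulr_ge0// ltW.
have key : phi x ^+ 2 <= m ^+ 2 * phi y ^+ 2.
  rewrite ex ey; have [y0|y0] := leP 0 y.
  - have : 1 - x <= (1 + 8 * N * m) * (1 - y) by lra.
    have := m_sqr.
    have : 0 < 1 - x by lra.
    have : 0 < 1 + 8 * N * m by rewrite addr_gt0// !mulr_gt0.
    move: (8 * N * m) => c c0 xm cm xy.
    have : (1 - x) * (1 + x) <= 2 * (1 + c) * (1 - y) by nra.
    have : 2 * (1 + c) * (1 - y) <= m ^+ 2 * (1 - y) by nra.
    have : 0 <= m ^+ 2 * (1 - y) * y by rewrite !mulr_ge0//; lra.
    lra.
  - have : 1 + x <= (1 + 8 * N * m) * (1 + y) by lra.
    have := m_sqr.
    have : 0 < 1 + x by lra.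
    have : 0 < 1 + 8 * N * m by rewrite addr_gt0// !mulr_gt0.
    move: (8 * N * m) => c c0 xm cm xy.
    have : (1 - x) * (1 + x) <= 2 * (1 + c) * (1 + y) by nra.
    have : 2 * (1 + c) * (1 + y) <= m ^+ 2 * (1 + y) by nra.
    have : 0 <= m ^+ 2 * (1 + y) * (- y) by rewrite !mulr_ge0//; lra.
    lra.
by rewrite -(@ler_pXn2r _ 2)// ?nnegrE ?exprMn//; [lra|nra].
Qed.

Lemma admissible_step_le x s y : admissible x s y -> s <= h * phi y.
Proof.
move=> adm; have := admissible_phi_le adm; have [xb s0 _ _ yb] := admissible_bounds adm.
case/and5P: adm => _ _ _ a4 _; move=> xy; rewrite -(ler_pM2l m0); apply: (le_trans a4).
by rewrite mulrCA ler_pM2l.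
Qed.

(** Both x lie within N h phi(x) / 2 <= 2 N^2 m s of y, hence the first bound. For the second, the
    right ends of the two large stencils lie between y + k s / 2 and 1, and
    [right_endpoint_expansion] carries this back to the centres at the cost of a factor 2; left ends
    follow by reflection. *)
Lemma admissible_diameter x1 x2 s y : admissible x1 s y -> admissible x2 s y ->
  `|x1 - x2| <= Num.min (4 * N ^+ 2 * m * s)
    (2 * Num.min (1 - y - k%:R * s / 2) (1 + y - k%:R * s / 2)).
Proof.
wlog x12 : x1 x2 / x1 <= x2 => [wl|].
  by move=> a1 a2; have [/wl|/ltW/wl] := leP x1 x2; [apply|rewrite distrC; apply].
move=> adm1 adm2; have [xb1 s0 _ _ yb] := admissible_bounds adm1.
have [xb2 _ _ _ _] := admissible_bounds adm2.
case/and5P: adm1 => a1 a2 a3 a4 /andP[a5 a6].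
case/and5P: adm2 => b1 b2 b3 b4 /andP[b5 b6].
rewrite distrC ger0_norm ?subr_ge0// le_min -[X in _ && X]ler_pdivrMl// le_min; apply/and3P; split.
- have ks : 0 <= k%:R * s by rewrite mulr_ge0// ltW.
  have : N * (h * phi x1) <= N * (4 * N * m * s) by rewrite ler_pM2l//; lra.
  have : N * (h * phi x2) <= N * (4 * N * m * s) by rewrite ler_pM2l//; lra.
  by rewrite expr2 -!mulrA !(mulrCA _ 4); lra.
- have Nh : 0 < N * h by rewrite mulr_gt0.
  have := @right_endpoint_expansion (N * h) x1 x2 Nh; rewrite -!mulrA.
  by move=> /(_ ltac:(lra) x12); lra.
- have Nh : 0 < N * h by rewrite mulr_gt0.
  have := @right_endpoint_expansion (N * h) (- x2) (- x1) Nh; rewrite !phiN -!mulrA.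
  by move=> /(_ ltac:(lra) ltac:(lra)); lra.
Qed.

(** The sum is 2 - k s, and k s is at most half the length of I because m >= 2. So the small stencil
    can be close to one endpoint only. *)
Lemma admissible_gap x s y : admissible x s y ->
  1 <= (1 - y - k%:R * s / 2) + (1 + y - k%:R * s / 2).
Proof.
move=> adm; have [xb s0 _ _ yb] := admissible_bounds adm.
case/and5P: adm => a1 a2 a3 a4 /andP[a5 a6].
have : k%:R * (2 * s) <= N * (m * s).
  apply: ler_pM => //; [by rewrite mulr_ge0// ltW|by rewrite Nk lerDl|].
  by rewrite ler_pM2r// mE; have := N2; lra.
have : N * (m * s) <= N * (h * phi x) by rewrite ler_pM2l.
lra.
Qed.

Definition distance_weight s y : R :=
  Num.sqrt (1 - y - k%:R * s / 2) * Num.sqrt (1 + y - k%:R * s / 2).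

(** With w the smaller of the two distances, phi(y)^2 <= 2 w + k s. The two terms are paired with
    the bounds (c s)^2 and 2 c s w on the square of the minimum, where c = 4 N^2 m; the larger
    distance is at least 1/2 by [admissible_gap]. *)
Lemma admissible_min_le x s y : admissible x s y ->
  phi y * Num.min (4 * N ^+ 2 * m * s)
      (2 * Num.min (1 - y - k%:R * s / 2) (1 + y - k%:R * s / 2)) <=
    (16 * N ^+ 2 * m) * s * distance_weight s y.
Proof.
move=> adm; have [xb s0 y1 y2 yb] := admissible_bounds adm.
have gap := admissible_gap adm.
rewrite /distance_weight -sqrtrM; last lra.
set u := 1 - y - k%:R * s / 2 in gap *; set v := 1 + y - k%:R * s / 2 in gap *.
have u0 : 0 < u by rewrite /u; lra.
have v0 : 0 < v by rewrite /v; lra.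
set c := 4 * N ^+ 2 * m.
have cN : N <= c.
  have -> : c = N * (4 * (N * m)) by rewrite /c; ring.
  rewrite ler_peMr// ?(ltW N0)//.
  have : 1 * 1 <= N * m by apply: ler_pM => //; [|rewrite mE]; have := N2; lra.
  lra.
have c1 : 1 <= c by have := N2; lra.
have ck : k%:R <= c by move: cN; rewrite Nk; lra.
have -> : 16 * N ^+ 2 * m = 4 * c by rewrite /c; ring.
clearbody c.
have d0 : 0 <= Num.min (c * s) (2 * Num.min u v).
  by rewrite le_min mulr_ge0 ?(ltW s0)//=; [rewrite mulr_ge0// le_min !ltW|lra].
rewrite -(@ler_pXn2r _ 2)// ?nnegrE; last 2 first.
- by rewrite mulr_ge0// phi_ge0.
- by rewrite !mulr_ge0// ?sqrtr_ge0//; lra.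
rewrite !exprMn (sqr_sqrtr (mulr_ge0 (ltW u0) (ltW v0))).
have ey : phi y ^+ 2 = (1 - y) * (1 + y) by apply: phi_sqr; lra.
set d := Num.min _ _ in d0 *.
have d1 : d <= c * s by rewrite ge_min lexx.
have d2 : d <= 2 * u by rewrite ge_min ler_pM2l// ge_min lexx orbT.
have d3 : d <= 2 * v by rewrite ge_min ler_pM2l// ge_min lexx !orbT.
have dd w : 0 <= w -> d <= 2 * w -> d ^+ 2 <= 2 * c * s * w.
  move=> w0 dw; have -> : 2 * c * s * w = (c * s) * (2 * w) by ring.
  by rewrite expr2 ler_pM.
have dc : d ^+ 2 <= c ^+ 2 * s ^+ 2 by rewrite -exprMn !expr2 ler_pM.
have key w w' : 0 < w -> d <= 2 * w -> 1 <= 2 * w' -> phi y ^+ 2 <= 2 * w + k%:R * s ->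
    phi y ^+ 2 * d ^+ 2 <= 4 ^+ 2 * c ^+ 2 * s ^+ 2 * (w * w').
  move=> w0 dw w'1 phw.
  have := dd w (ltW w0) dw; have : 0 <= d ^+ 2 by rewrite sqr_ge0.
  move: (d ^+ 2) dc => e ec e0 e1.
  have f0 : 0 <= phi y ^+ 2 by rewrite sqr_ge0.
  have : phi y ^+ 2 * e <= (2 * w + k%:R * s) * e by rewrite ler_wpM2r.
  have cs : 0 <= c ^+ 2 * s ^+ 2 by rewrite mulr_ge0// sqr_ge0.
  have : 2 * w * e <= 2 * w * (c ^+ 2 * s ^+ 2) by rewrite ler_wpM2l//; lra.
  have : k%:R * s * e <= c * s * (2 * c * s * w).
    apply: ler_pM => //; [by rewrite mulr_ge0// ltW|by rewrite ler_wpM2r// ltW].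
  have : (c ^+ 2 * s ^+ 2 * w) * 1 <= (c ^+ 2 * s ^+ 2 * w) * (2 * w').
    by rewrite ler_wpM2l// mulr_ge0// ltW.
  have : 0 <= c ^+ 2 * s ^+ 2 * w by rewrite mulr_ge0// ltW.
  by rewrite !expr2; lra.
have [uv|vu] := leP u v.
- apply: key => //; first lra.
  by rewrite ey /u; nra.
- by rewrite (mulrC u); apply: key => //; [lra|rewrite ey /v; nra].
Qed.

End admissible.
End geometry.

Section kernel.
Context {R : realType}.
Local Notation mu := (@lebesgue_measure R).

Lemma measurable_inv : measurable_fun setT (fun x : R => x^-1).
Proof.
rewrite (_ : (fun x => _) = fun x : R => if 0 <= x then x `^ (-1) else - (- x) `^ (-1)).
  apply: measurable_fun_ifT => //.
  - exact: measurable_fun_ler.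
  - apply: (measurableT_comp (@oppr_measurable R setT)).
    exact: (measurableT_comp (measurable_powR _) (@oppr_measurable R setT)).
apply/funext => x; case: ifPn => [x0|]; first by rewrite powR_inv1.
by rewrite -ltNge => x0; rewrite powR_inv1 ?oppr_ge0 ?ltW// invrN opprK.
Qed.

Lemma measurable_sqrt : measurable_fun setT (@Num.sqrt R).
Proof. by apply: continuous_measurable_fun; exact: sqrt_continuous. Qed.

Lemma measurable_phi : measurable_fun setT (@phi R).
Proof.
by apply: (measurableT_comp measurable_sqrt); apply: measurable_funB.
Qed.

(** The exact value 2 (sqrt(e - p) - sqrt(e - q)) is rationalised to get a bound proportional to q -
    p, which later cancels the factor 1 / (h phi(x)) of the kernel. *)
Lemma integral_inv_sqrt (p q e : R) : p < q -> q < e ->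
  (\int[mu]_(y in `[p, q]) ((Num.sqrt (e - y))^-1)%:E <= (2 * (q - p) / Num.sqrt (e - p))%:E)%E.
Proof.
move=> pq qe.
pose F (y : R) := - 2 * Num.sqrt (e - y).
have dF y : y < e -> is_derive y 1 F (Num.sqrt (e - y))^-1.
  move=> ye; have e0 : 0 < e - y by lra.
  have h := is_derive1_sqrt e0.
  have : is_derive y 1 (Num.sqrt \o (fun y => e - y)) ((2 * Num.sqrt (e - y))^-1 * -1).
    apply: is_derive1_comp.
    rewrite -[X in is_derive _ _ _ X]sub0r; exact: is_deriveB.
  move=> h1; rewrite /F.
  apply: is_derive_eq.
  have s0 : Num.sqrt (e - y) != 0 by rewrite lt0r_neq0// sqrtr_gt0.
  by rewrite /GRing.scale/=; field.
have cF y : y < e -> {for y, continuous F}.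
  by move=> ye; apply/differentiable_continuous/derivable1_diffP; case: (dF _ ye).
have cf : {within `[p, q], continuous (fun y => (Num.sqrt (e - y))^-1)}.
  apply: continuous_in_subspaceT => y; rewrite inE/= in_itv/= => /andP[py yq].
  apply: cvgV; first by rewrite lt0r_neq0// sqrtr_gt0; lra.
  apply: continuous_comp; last exact: sqrt_continuous.
  by apply: cvgB; [exact: cvg_cst|exact: cvg_id].
rewrite (continuous_FTC2 pq cf (F := F)); last 2 first.
- split.
  + by move=> y; rewrite in_itv/= => /andP[_ yq]; case: (dF y ltac:(lra)).
  + by apply: cvg_at_right_filter; apply: cF; lra.
  + by apply: cvg_at_left_filter; apply: cF; lra.
- move=> y; rewrite in_itv/= => /andP[_ yq].
  have ye : y < e by lra.
  by rewrite derive1E; have [_ ->] := dF y ye.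
rewrite -EFinB lee_fin /F.
have a0 : 0 < e - p by lra.
have b0 : 0 < e - q by lra.
have ea : Num.sqrt (e - p) ^+ 2 = e - p by rewrite sqr_sqrtr// ltW.
have eb : Num.sqrt (e - q) ^+ 2 = e - q by rewrite sqr_sqrtr// ltW.
have sa : 0 < Num.sqrt (e - p) by rewrite sqrtr_gt0.
have sb : 0 < Num.sqrt (e - q) by rewrite sqrtr_gt0.
rewrite ler_pdivlMr//.
have -> : q - p = Num.sqrt (e - p) ^+ 2 - Num.sqrt (e - q) ^+ 2 by rewrite ea eb; ring.
have : Num.sqrt (e - q) <= Num.sqrt (e - p) by rewrite ler_wsqrtr//; lra.
by move: (Num.sqrt (e - q)) (Num.sqrt (e - p)) sa sb {ea eb} => u v u0 v0; nra.
Qed.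

Lemma integral_inv_sqrt_opp (p q e : R) : p < q -> e < p ->
  (\int[mu]_(y in `[p, q]) ((Num.sqrt (y - e))^-1)%:E <= (2 * (q - p) / Num.sqrt (q - e))%:E)%E.
Proof.
move=> pq ep.
apply: (@le_trans _ _ (\int[mu]_(y in `[(- q)%R, (- p)%R]) ((Num.sqrt (- e - y))^-1)%:E)%E); last first.
  have qp : - q < - p by lra.
  have pe : - p < - e by lra.
  apply: (le_trans (integral_inv_sqrt qp pe)); rewrite lee_fin le_eqVlt; apply/orP; left; apply/eqP.
  by congr (_ * _ / Num.sqrt _); ring.
have := @ge0_le_integral_affine R (fun y => ((Num.sqrt (- e - y))^-1)%:E) (-1) 0 p q (- q) (- p).
have -> : (\int[mu]_(v in `[p, q]) ((Num.sqrt (- e - (-1 * v + 0)))^-1)%:E =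
  \int[mu]_(v in `[p, q]) ((Num.sqrt (v - e))^-1)%:E)%E.
  apply: eq_integral => v _; congr ((Num.sqrt _)^-1)%:E; ring.
apply.
- apply/measurable_EFinP; apply: (measurableT_comp measurable_inv).
  by apply: (measurableT_comp measurable_sqrt); apply: measurable_funB.
- by move=> y; rewrite lee_fin invr_ge0 sqrtr_ge0.
- by rewrite normrN normr1.
- by move=> v; lra.
Qed.

Section kernel.
Variables (k : nat) (h : R).
Hypotheses (k0 : (0 < k)%N) (h0 : 0 < h).
Let N : R := k.+1%:R.
Let m : R := (subdivisions k)%:R.
Let mE : m = 16 * N + 1.
Proof. by rewrite /m /subdivisions natrD natrM. Qed.
Let N0 : 0 < N. Proof. by rewrite /N. Qed.
Let N1 : 1 <= N. Proof. by rewrite /N ler1n. Qed.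
Let m0 : 0 < m. Proof. by rewrite mE; have := N0; lra. Qed.

(** The first factor comes from the averaging estimate, the second from the change of weight; the
    Jacobian phi(y) of s = tau phi(y) is added in [schur_kernel]. *)
Definition kernel x s y : R :=
  if admissible k h x s y then (h * phi x)^-1 * (distance_weight k s y)^-1 else 0.

Lemma kernel_ge0 x s y : 0 <= kernel x s y.
Proof.
rewrite /kernel; case: ifP => // _.
by rewrite mulr_ge0 ?invr_ge0 ?mulr_ge0 ?phi_ge0 ?sqrtr_ge0 // ltW.
Qed.

Lemma measurable_admissible :
  measurable_fun setT (fun p : R * (R * R) => admissible k h p.1 p.2.1 p.2.2).
Proof.
have mx : measurable_fun setT (fun p : R * (R * R) => p.1) by exact: measurable_fst.
have ms : measurable_fun setT (fun p : R * (R * R) => p.2.1).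
  by apply: measurableT_comp measurable_fst measurable_snd.
have my : measurable_fun setT (fun p : R * (R * R) => p.2.2).
  by apply: measurableT_comp measurable_snd measurable_snd.
have mphi : measurable_fun setT (fun p : R * (R * R) => h * phi p.1).
  by apply: measurable_funM => //; exact: (measurableT_comp measurable_phi mx).
have mNphi : measurable_fun setT (fun p : R * (R * R) => k.+1%:R * (h * phi p.1) / 2).
  by apply: measurable_funM => //; apply: measurable_funM.
have mks : measurable_fun setT (fun p : R * (R * R) => k%:R * p.2.1 / 2).
  by apply: measurable_funM => //; apply: measurable_funM.
apply: measurable_and; [|apply: measurable_and; [|apply: measurable_and;
  [|apply: measurable_and; [|apply: measurable_and]]]].
- by apply: measurable_fun_ltr => //; apply: measurable_funB.
- by apply: measurable_fun_ltr => //; apply: measurable_funD.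
- by apply: measurable_fun_ler => //; apply: measurable_funM.
- by apply: measurable_fun_ler => //; apply: measurable_funM.
- by apply: measurable_fun_ltr => //; apply: measurable_funD => //; apply: measurable_funB.
- by apply: measurable_fun_ltr => //; apply: measurable_funB => //; apply: measurable_funD.
Qed.

Lemma measurable_kernel :
  measurable_fun setT (fun p : R * (R * R) => kernel p.1 p.2.1 p.2.2).
Proof.
have mx : measurable_fun setT (fun p : R * (R * R) => p.1) by exact: measurable_fst.
have ms : measurable_fun setT (fun p : R * (R * R) => p.2.1).
  by apply: measurableT_comp measurable_fst measurable_snd.
have my : measurable_fun setT (fun p : R * (R * R) => p.2.2).
  by apply: measurableT_comp measurable_snd measurable_snd.
have mphi : measurable_fun setT (fun p : R * (R * R) => h * phi p.1).
  by apply: measurable_funM => //; exact: (measurableT_comp measurable_phi mx).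
have mNphi : measurable_fun setT (fun p : R * (R * R) => k.+1%:R * (h * phi p.1) / 2).
  by apply: measurable_funM => //; apply: measurable_funM.
have mks : measurable_fun setT (fun p : R * (R * R) => k%:R * p.2.1 / 2).
  by apply: measurable_funM => //; apply: measurable_funM.
apply: measurable_fun_ifT => //; first exact: measurable_admissible.
apply: measurable_funM; first exact: (measurableT_comp measurable_inv mphi).
  apply: (measurableT_comp measurable_inv); apply: measurable_funM;
    apply: (measurableT_comp measurable_sqrt); apply: measurable_funB => //.
  + exact: measurable_funB.
  + exact: measurable_funD.
Qed.

Lemma measurable_kernel_pair x : measurable_fun setT (fun p : R * R => kernel x p.1 p.2).
Proof.
have mp : measurable_fun setT (fun p : R * R => (x, p)) by exact: measurable_fun_pair.
exact: (measurableT_comp measurable_kernel mp).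
Qed.

Lemma measurable_kernel_right x s : measurable_fun setT (fun y => kernel x s y).
Proof.
have mp : measurable_fun setT (fun y : R => (s, y)) by exact: measurable_fun_pair.
exact: (measurableT_comp (measurable_kernel_pair x) mp).
Qed.

Lemma measurable_kernel_left s y : measurable_fun setT (fun x => kernel x s y).
Proof.
have mp : measurable_fun setT (fun x : R => (x, (s, y))) by exact: measurable_fun_pair.
exact: (measurableT_comp measurable_kernel mp).
Qed.

(** The two distances add up to at least 1, so the inverse of the product of their roots is at most
    twice the sum of the inverse roots, and one endpoint singularity is integrated at a time. The
    y-integral is at most 16 N / phi(x), s ranges over a length at most h phi(x) / m, and 16 N <=
    m. *)
Lemma integral_kernel_left x :
  (\int[mu]_s \int[mu]_y (kernel x s y)%:E <= h%:E)%E.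
Proof.
set e := h * phi x.
have [good|bad] := boolP ((-1 < x - N * e / 2) && (x + N * e / 2 < 1)); last first.
  rewrite (eq_integral (cst 0%E)) ?integral0 ?lee_fin ?ltW// => s _.
  rewrite (eq_integral (cst 0%E)) ?integral0// => y _.
  by rewrite /kernel ifF//; apply: contraNF bad => /and3P[-> ->].
case/andP: good => xa xb.
have Ne0 : 0 <= N * e by rewrite mulr_ge0 ?mulr_ge0 ?phi_ge0// ltW.
have x1 : -1 < x < 1 by lra.
have f0 := phi_gt0 x1; have e0 : 0 < e by rewrite mulr_gt0.
have ef : phi x ^+ 2 = (1 - x) * (1 + x) by apply: phi_sqr; lra.
have inner s : 0 <= s -> m * s <= e ->
    (\int[mu]_y (kernel x s y)%:E <= (16 * N / phi x)%:E)%E.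
  move=> s0 se; set ks := k%:R * s.
  have ks0 : 0 <= ks by rewrite mulr_ge0.
  have kse : ks <= N * e / 2.
    have : ks <= N * s by rewrite ler_wpM2r// ler_nat.
    have : N * (2 * s) <= N * (m * s).
      by rewrite ler_pM2l// ler_wpM2r// mE; have := N1; lra.
    have : N * (m * s) <= N * e by rewrite ler_pM2l.
    lra.
  pose p := x - N * e / 2 + ks / 2; pose q := x + N * e / 2 - ks / 2.
  have Ne1 : 0 < N * e by rewrite mulr_gt0.
  have pq : p < q by rewrite /p /q; lra.
  pose u y := Num.sqrt ((1 - ks / 2) - y).
  pose v y := Num.sqrt (y - (-1 + ks / 2)).
  have mu_ : measurable_fun setT (fun y => (u y)^-1).
    apply: (measurableT_comp measurable_inv).
    by apply: (measurableT_comp measurable_sqrt); apply: measurable_funB.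
  have mv_ : measurable_fun setT (fun y => (v y)^-1).
    apply: (measurableT_comp measurable_inv).
    by apply: (measurableT_comp measurable_sqrt); apply: measurable_funB.
  have u0 y : 0 <= (u y)^-1 by rewrite invr_ge0 sqrtr_ge0.
  have v0 y : 0 <= (v y)^-1 by rewrite invr_ge0 sqrtr_ge0.
  have c0 : 0 <= e^-1 * 2 by rewrite mulr_ge0// invr_ge0 ltW.
  have muv : measurable_fun setT (fun y => ((u y)^-1%:E + (v y)^-1%:E)%E).
    by apply: emeasurable_funD; exact/measurable_EFinP.
  apply: (@le_trans _ _ (\int[mu]_(y in `[p, q])
      ((e^-1 * 2)%:E * ((u y)^-1%:E + (v y)^-1%:E)))%E).
    rewrite [leRHS]integral_mkcond; apply: ge0_le_integral => //.
    - by move=> y _; rewrite lee_fin kernel_ge0.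
    - by apply/measurable_EFinP; exact: measurable_kernel_right.
    - apply/(measurable_restrictT _ _).1 => //; apply: measurable_funTS.
      by apply: emeasurable_funM.
    - move=> y _; rewrite patchE /kernel; case: ifPn => [adm|_]; last first.
        by case: ifP => // _; apply: mule_ge0; rewrite ?adde_ge0 ?lee_fin.
      have [_ _ y1 y2 yb] := admissible_bounds k0 h0 adm.
      have gap := admissible_gap k0 h0 adm.
      rewrite mem_set; last first.
        case/and5P: adm => _ _ _ _ /andP[a5 a6].
        by rewrite /= in_itv/= !ltW.
      rewrite -EFinD -EFinM lee_fin -mulrA ler_wpM2l ?invr_ge0 ?(ltW e0)//.
      have -> : distance_weight k s y = u y * v y.
        by rewrite /distance_weight /u /v; congr (Num.sqrt _ * Num.sqrt _); rewrite /ks; ring.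
      have uE : u y ^+ 2 = (1 - ks / 2) - y by rewrite sqr_sqrtr// /ks; lra.
      have vE : v y ^+ 2 = y - (-1 + ks / 2) by rewrite sqr_sqrtr// /ks; lra.
      have U0 : 0 < u y by rewrite sqrtr_gt0 /ks; lra.
      have V0 : 0 < v y by rewrite sqrtr_gt0 /ks; lra.
      have uv1 : 1 <= u y ^+ 2 + v y ^+ 2 by rewrite uE vE /ks; lra.
      rewrite -(ler_pM2l (mulr_gt0 U0 V0)) mulfV ?lt0r_neq0 ?mulr_gt0//.
      have -> : u y * v y * (2 * ((u y)^-1 + (v y)^-1)) = 2 * (u y + v y).
        by field; rewrite !lt0r_neq0.
      nra.
  rewrite ge0_integralZl_EFin//; last 2 first.
  - by move=> y _; rewrite adde_ge0 ?lee_fin.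
  - exact: measurable_funTS.
  have mu' : measurable_fun (`[p, q] : set R) (fun y => (u y)^-1%:E).
    by apply: measurable_funTS; exact/measurable_EFinP.
  have mv' : measurable_fun (`[p, q] : set R) (fun y => (v y)^-1%:E).
    by apply: measurable_funTS; exact/measurable_EFinP.
  rewrite ge0_integralD//; try by move=> y _; rewrite lee_fin.
  have qe1 : q < 1 - ks / 2 by rewrite /q; lra.
  have pe2 : -1 + ks / 2 < p by rewrite /p; lra.
  apply: (@le_trans _ _ ((e^-1 * 2)%:E * ((4 * N * e / phi x)%:E + (4 * N * e / phi x)%:E))%E).
    apply: lee_wpmul2l; first by rewrite lee_fin.
    (* [w] will be the distance from the singularity to the far end of [p, q]; it is at least 1 - x
       or 1 + x because k s <= N e / 2. *)
    have bound w : (phi x / 2) ^+ 2 <= w -> 2 * (q - p) / Num.sqrt w <= 4 * N * e / phi x.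
      move=> fw; have sw : phi x / 2 <= Num.sqrt w.
        have p2 : 0 <= phi x / 2 by lra.
        by rewrite -[leLHS](ger0_norm p2) -sqrtr_sqr ler_wsqrtr.
      have sw0 : 0 < Num.sqrt w by lra.
      rewrite ler_pdivrMr// mulrAC ler_pdivlMr//.
      have : 0 <= 2 * (q - p) by lra.
      have : q - p <= N * e by rewrite /p /q; lra.
      move: (Num.sqrt w) sw sw0 => S sw sw0 qp qp0.
      have : (q - p) * phi x <= (N * e) * (2 * S) by apply: ler_pM => //; lra.
      lra.
    apply: leeD.
    - apply: le_trans (integral_inv_sqrt pq qe1) _; rewrite lee_fin bound//.
      by rewrite exprMn ef /p; nra.
    - apply: le_trans (integral_inv_sqrt_opp pq pe2) _; rewrite lee_fin bound//.
      by rewrite exprMn ef /q; nra.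
  rewrite -EFinD -EFinM lee_fin le_eqVlt; apply/orP; left; apply/eqP.
  by field; rewrite !lt0r_neq0.
have em : 0 < e / m by rewrite divr_gt0.
apply: (@le_trans _ _ (\int[mu]_(s in `[0%R, (e / m)%R]) (16 * N / phi x)%:E)%E).
  rewrite [leRHS]integral_mkcond; apply: ge0_le_integral => //.
  - by move=> s _; apply: integral_ge0 => y _; rewrite lee_fin kernel_ge0.
  - apply: (@measurable_fun_fubini_tonelli_F _ _ _ _ R mu (fun p => (kernel x p.1 p.2)%:E)).
      by apply/measurable_EFinP; exact: measurable_kernel_pair.
    by move=> p; rewrite lee_fin kernel_ge0.
  - by apply/(measurable_restrictT _ _).1 => //; exact: measurable_cst.
  - move=> s _; rewrite patchE; case: ifPn => [|nsE].
      rewrite inE/= in_itv/= => /andP[s0 se]; apply: inner => //.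
      by move: se; rewrite ler_pdivlMr// mulrC.
    rewrite (eq_integral (cst 0%E)) ?integral0// => y _; rewrite /kernel ifF//.
    apply: contraNF nsE => adm; have [_ s0 _ _ _] := admissible_bounds k0 h0 adm.
    case/and5P: adm => _ _ _ a4 _.
    by rewrite inE/= in_itv/= (ltW s0)/= ler_pdivlMr// mulrC.
rewrite integral_cst//= lebesgue_measure_itv/= lte_fin em oppr0 adde0 -EFinM lee_fin.
have -> : 16 * N / phi x * (e / m) = h * (16 * N / m).
  by rewrite /e; field; rewrite !lt0r_neq0.
by rewrite ler_piMr ?(ltW h0)// ler_pdivrMr// mE; lra.
Qed.

(** All admissible x lie within D of any one of them, and there h phi(x) >= m s. Then
    [admissible_min_le] bounds phi(y) D, and the length 2 D doubles its constant 16 N^2. *)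
Lemma integral_kernel_right s y :
  ((phi y)%:E * \int[mu]_x (kernel x s y)%:E <= (32 * N ^+ 2)%:E)%E.
Proof.
have [[x0 adm0]|nadm] := pselect (exists x0, admissible k h x0 s y); last first.
  rewrite (eq_integral (cst 0%E)) ?integral0 ?mule0 ?lee_fin ?mulr_ge0 ?sqr_ge0// => x _.
  by rewrite /kernel ifF//; apply/negbTE/negP => adm; apply: nadm; exists x.
have [xb s0 y1 y2 yb] := admissible_bounds k0 h0 adm0.
have ms0 : 0 < m * s by rewrite mulr_gt0.
set D := Num.min (4 * N ^+ 2 * m * s)
  (2 * Num.min (1 - y - k%:R * s / 2) (1 + y - k%:R * s / 2)).
have D0 : 0 < D.
  rewrite /D lt_min !mulr_gt0// ?exprn_gt0//= lt_min.
  by apply/andP; split; lra.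
have W0 : 0 < distance_weight k s y by rewrite mulr_gt0// sqrtr_gt0; lra.
have phD : phi y * D <= 16 * N ^+ 2 * m * s * distance_weight k s y.
  exact: (admissible_min_le k0 h0 adm0).
apply: (@le_trans _ _ ((phi y)%:E *
    \int[mu]_(x in `[(x0 - D)%R, (x0 + D)%R]) ((m * s)^-1 * (distance_weight k s y)^-1)%:E)%E).
  apply: lee_wpmul2l; first by rewrite lee_fin phi_ge0.
  rewrite [leRHS]integral_mkcond; apply: ge0_le_integral => //.
  - by move=> x _; rewrite lee_fin kernel_ge0.
  - by apply/measurable_EFinP; exact: measurable_kernel_left.
  - by apply/(measurable_restrictT _ _).1 => //; exact: measurable_cst.
  - move=> x _; rewrite patchE /kernel; case: ifPn => [adm|_]; last first.
      by case: ifP => // _; rewrite lee_fin mulr_ge0// invr_ge0 ltW.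
    rewrite mem_set; last first.
      have := admissible_diameter k0 h0 adm0 adm; rewrite -/D ler_norml => /andP[d1 d2].
      by rewrite /= in_itv/=; lra.
    rewrite lee_fin ler_wpM2r ?invr_ge0 ?(ltW W0)//.
    have [x1 _ _ _ _] := admissible_bounds k0 h0 adm.
    have he : 0 < h * phi x by rewrite mulr_gt0// phi_gt0.
    rewrite lef_pV2 ?posrE//.
    by case/and5P: adm.
rewrite integral_cst//= lebesgue_measure_itv/= lte_fin.
have -> : x0 - D < x0 + D by lra.
rewrite -EFinB -!EFinM lee_fin.
have -> : x0 + D - (x0 - D) = 2 * D by ring.
have -> : phi y * ((m * s)^-1 * (distance_weight k s y)^-1 * (2 * D)) =
  2 * (phi y * D) / (m * s * distance_weight k s y).
  by field; rewrite !lt0r_neq0.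
rewrite ler_pdivrMr ?(mulr_gt0 ms0 W0)//.
move: (distance_weight k s y) phD => w phD; lra.
Qed.

End kernel.
End kernel.

(** * Schur's test *)

Section schur.
Context {R : realType}.
Local Notation mu := (@lebesgue_measure R).

Let T := measurableTypeR R.

Lemma product_lebesgue_sigma_finite : sigma_finite [set: T * T] (mu \x mu)%E.
Proof.
have /sigma_finiteP[F [TF ndF Foo]] := sigma_finiteT mu.
exists (fun n => F n `*` F n).
  rewrite -setXTT TF predeqE => -[x y]; split.
    move=> [/= [n _ Fnx] [l _ Fly]]; exists (maxn n l) => //; split.
    - by move: x Fnx; exact/subsetPset/ndF/leq_maxl.
    - by move: y Fly; exact/subsetPset/ndF/leq_maxr.
  by move=> [n _ []/= ? ?]; split; exists n.
move=> n; have [mFn Fn] := Foo n; split; first exact: measurableX.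
by rewrite product_measure1E// lte_mul_pinfty// ge0_fin_numE.
Qed.

(** A separate name for the product measure, to which a sigma-finite structure is attached for
    Tonelli on R * (R * R). *)
Definition lebesgue2 : set (T * T)%type -> \bar R := (mu \x mu)%E.
HB.instance Definition _ := Measure.on lebesgue2.
HB.instance Definition _ := Measure_isSigmaFinite.Build _ _ _ lebesgue2 product_lebesgue_sigma_finite.
Local Notation mm := (lebesgue2 : {sigma_finite_measure set (T * T)%type -> \bar R}).
Lemma measurable_integral_plane (f : R * (R * R) -> \bar R) (mf : measurable_fun setT f) (f0 : forall x, (0 <= f x)%E) :
  measurable_fun setT (fun x => \int[mu \x mu]_z f (x, z))%E.
Proof.
exact: (@measurable_fun_fubini_tonelli_F _ _ T (T * T)%type R mm f mf f0).
Qed.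
Lemma measurable_integral_line (f : R * (R * R) -> \bar R) (mf : measurable_fun setT f) (f0 : forall x, (0 <= f x)%E) :
  measurable_fun setT (fun z => \int[mu]_x f (x, z))%E.
Proof.
exact: (@measurable_fun_fubini_tonelli_G _ _ T (T * T)%type R mu f mf f0).
Qed.
Lemma fubini_tonelli_line_plane (f : R * (R * R) -> \bar R) (mf : measurable_fun setT f) (f0 : forall x, (0 <= f x)%E) :
  (\int[mu]_x \int[mu \x mu]_z f (x, z) = \int[mu \x mu]_z \int[mu]_x f (x, z))%E.
Proof.
exact: (@fubini_tonelli _ _ T (T * T)%type R mu mm f mf f0).
Qed.

Lemma ge0_le_poweR (r : R) (x y : \bar R) : 0 <= r -> (0 <= x)%E -> (x <= y)%E ->
  (x `^ r <= y `^ r)%E.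
Proof.
move=> r0 x0 xy; apply: gt0_ler_poweR => //; rewrite in_itv/= ?x0 ?leey//.
by rewrite (le_trans x0 xy).
Qed.

(** Hoelder for the factorisation M F = M^(1/q) (M^(1/r) F) with conjugate exponents q and r. For r
    = 1, where q is not finite, both sides are equal. *)
Lemma jensen_kernel d (X : measurableType d) (nu : {measure set X -> \bar R})
    (M F : X -> R) (L r : R) : 1 <= r -> 0 <= L ->
  measurable_fun setT M -> measurable_fun setT F ->
  (forall z, 0 <= M z) -> (forall z, 0 <= F z) -> (\int[nu]_z (M z)%:E <= L%:E)%E ->
  ((\int[nu]_z (M z * F z)%:E) `^ r <=
    (L `^ (r - 1))%:E * \int[nu]_z (M z * F z `^ r)%:E)%E.
Proof.
move=> r1 L0 mM mF M0 F0 ML.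
have IMF0 : (0 <= \int[nu]_z (M z * F z)%:E)%E.
  by apply: integral_ge0 => z _; rewrite lee_fin mulr_ge0.
have IMFr0 : (0 <= \int[nu]_z (M z * F z `^ r)%:E)%E.
  by apply: integral_ge0 => z _; rewrite lee_fin mulr_ge0// powR_ge0.
have IM0 : (0 <= \int[nu]_z (M z)%:E)%E.
  by apply: integral_ge0 => z _; rewrite lee_fin.
move: r1; rewrite le_eqVlt => /predU1P[<-|r1].
  rewrite subrr powRr0 mul1e (poweRe1 IMF0).
  by under [leRHS]eq_integral do rewrite powRr1//.
have r0 : 0 < r by lra.
have rm0 : 0 < r - 1 by lra.
pose q := r / (r - 1).
have q0 : 0 < q by rewrite divr_gt0.
have qr : q^-1 + r^-1 = 1 by rewrite /q; field; rewrite !lt0r_neq0.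
have mfq : measurable_fun setT (fun z => M z `^ q^-1) by apply: (measurableT_comp (measurable_powR _)).
have mgr : measurable_fun setT (fun z => M z `^ r^-1 * F z).
  by apply: measurable_funM => //; apply: (measurableT_comp (measurable_powR _)).
have := hoelder nu mfq mgr q0 r0 qr.
rewrite Lnorm1.
have -> : (\int[nu]_x `|(EFin \o ((fun z => M z `^ q^-1) \* (fun z => M z `^ r^-1 * F z))%R) x|
   = \int[nu]_z (M z * F z)%:E)%E.
  apply: eq_integral => z _ /=.
  rewrite mulrA -powRD; last by rewrite qr oner_eq0.
  by rewrite qr powRr1// ger0_norm// mulr_ge0.
move=> H; apply: (le_trans (ge0_le_poweR (ltW r0) IMF0 H)).
rewrite poweRM ?Lnorm_ge0// poweR_Lnorm ?lt0r_neq0//.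
apply: lee_pmul; rewrite ?poweR_ge0//.
- by apply: integral_ge0 => z _; rewrite poweR_ge0.
- rewrite unlock /= -poweRrM.
  have -> : q^-1 * r = r - 1 by rewrite /q; field; rewrite !lt0r_neq0.
  rewrite -poweR_EFin; apply: ge0_le_poweR; first exact: ltW.
    by apply: integral_ge0 => z _; rewrite lee_fin powR_ge0.
  apply: le_trans ML; rewrite le_eqVlt; apply/orP; left; apply/eqP.
  apply: eq_integral => z _ /=.
  by rewrite ger0_norm ?powR_ge0// -powRrM mulVf ?lt0r_neq0// powRr1.
- rewrite le_eqVlt; apply/orP; left; apply/eqP; apply: eq_integral => z _ /=.
  rewrite ger0_norm ?mulr_ge0 ?powR_ge0// powRM ?powR_ge0//.
  by rewrite -powRrM mulVf ?lt0r_neq0// powRr1.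
Qed.

(** The integral of a nonnegative function is a supremum over simple functions below it, so
    monotonicity holds without measurability. *)
Lemma le_integralT d (X : measurableType d) (nu : {measure set X -> \bar R}) (f g : X -> \bar R) :
  (forall x, 0 <= f x)%E -> (forall x, f x <= g x)%E ->
  (\int[nu]_x f x <= \int[nu]_x g x)%E.
Proof.
move=> f0 fg; have g0 x : (0 <= g x)%E by apply: le_trans (fg x).
rewrite !ge0_integralTE//; apply: le_ereal_sup => _ [u uf <-]; exists u => //= x.
exact: le_trans (fg x).
Qed.

(** Only g is measurable: raising it to +oo on a null set makes the comparison hold everywhere and
    leaves its integral unchanged. *)
Lemma ae_le_integralT (f g : R -> \bar R) : (forall x, 0 <= f x)%E ->
  (forall x, 0 <= g x)%E -> measurable_fun setT g -> {ae mu, forall x, (f x <= g x)%E} ->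
  (\int[mu]_x f x <= \int[mu]_x g x)%E.
Proof.
move=> f0 g0 mg [A [mA A0 fgA]].
pose a : R -> \bar R := (cst +oo%E) \_ A.
pose g' x := maxe (g x) (a x).
have ma : measurable_fun setT a.
  by apply/(measurable_restrictT _ _).1 => //; exact: measurable_cst.
apply: (@le_trans _ _ (\int[mu]_x g' x)%E).
  apply: le_integralT => // x; rewrite /g' /a patchE le_max.
  case: ifPn => [_|]; first by rewrite leey orbT.
  rewrite notin_setE => nA; apply/orP; left.
  by apply: contrapT => fg; apply: nA; exact: fgA.
rewrite le_eqVlt; apply/orP; left; apply/eqP; apply: ae_eq_integral => //.
- exact: measurable_maxe.
- exists A; split => // x /= nx; apply: contrapT => nA; apply: nx => _.
  by rewrite /g' /a patchE memNset// max_l.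
Qed.

Lemma lebesgue_measure_setT_gt0 : (0 < mu setT)%E.
Proof.
apply: (@lt_le_trans _ _ (mu (`[0%R, 1%R]%classic : set R))).
  by rewrite lebesgue_measure_itv/= lte_fin ltr01 oppr0 adde0 lte_fin.
by apply: le_measure; rewrite ?inE//; exact: measurable_itv.
Qed.

(** The second marginal carries 1 / t because F lives on the slices 0 < s <= t: for finite p, L^(p -
    1) (L / t) times the bound t omega^p on the integral of F^p is exactly (L omega)^p. For p = +oo
    the first marginal suffices. *)
Lemma schur_test (p omega : \bar R) (f : R -> R) (M : R -> R * R -> R) (F : R * R -> R)
    (L t : R) : (1 <= p)%E -> 0 < L -> 0 < t ->
  measurable_fun setT (fun u : R * (R * R) => M u.1 u.2) ->
  measurable_fun setT F -> (forall x z, 0 <= M x z) -> (forall z, 0 <= F z) ->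
  (forall x, (\int[mu \x mu]_z (M x z)%:E <= L%:E)%E) ->
  (forall z, (\int[mu]_x (M x z)%:E <= (L / t)%:E)%E) ->
  {ae mu, forall x, (`|f x|%:E <= \int[mu \x mu]_z (M x z * F z)%:E)%E} ->
  (forall y s, ~~ (0 < s <= t) -> F (y, s) = 0) ->
  (forall s : R, 0 < s <= t -> (Lnorm mu p (fun y => (F (y, s))%:E) <= omega)%E) ->
  (Lnorm mu p (EFin \o f) <= L%:E * omega)%E.
Proof.
move=> p1 L0 t0 mM mF M0 F0 ML MR fMF Ft Fo.
have omega0 : (0 <= omega)%E by apply: le_trans (Fo t _); rewrite ?Lnorm_ge0// t0 lexx.
have mMx x : measurable_fun setT (M x).
  have mp : measurable_fun setT (fun z : R * R => (x, z)) by exact: measurable_fun_pair.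
  exact: (measurableT_comp mM mp).
have mMxE x : measurable_fun setT (fun z => (M x z)%:E) by exact/measurable_EFinP.
have M0E x z : (0 <= (M x z)%:E)%E by rewrite lee_fin.
have mMz z : measurable_fun setT (fun x => M x z).
  have mp : measurable_fun setT (fun x : R => (x, z)) by exact: measurable_fun_pair.
  exact: (measurableT_comp mM mp).
have [->|omega_fin] := eqVneq omega +oo%E; first by rewrite gt0_muley ?lte_fin// leey.
have omegaE : omega = (fine omega)%:E by rewrite fineK// ge0_fin_numE// ltey.
have o0 : 0 <= fine omega by rewrite fine_ge0.
have mFs s : measurable_fun setT (fun y => F (y, s)).
  have mp : measurable_fun setT (fun y : R => (y, s)) by exact: measurable_fun_pair.
  exact: (measurableT_comp mF mp).
have mG : measurable_fun setT (fun u : R * (R * R) => F u.2).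
  exact: (measurableT_comp mF measurable_snd).
case: p p1 Fo => [r||] // r1 Fo; last first.
  rewrite unlock/= lebesgue_measure_setT_gt0.
  apply/ess_supP; apply: ae_imp fMF => x /= fx; apply: (le_trans fx).
  have mMF : measurable_fun setT (fun z => (M x z * F z)%:E).
    by apply/measurable_EFinP; apply: measurable_funM.
  have mMo : measurable_fun setT (fun z => (M x z * fine omega)%:E).
    by apply/measurable_EFinP; apply: measurable_funM.
  apply: (@le_trans _ _ (\int[mu \x mu]_z (M x z * fine omega)%:E)%E); last first.
    under eq_integral do rewrite mulrC EFinM.
    rewrite ge0_integralZl_EFin//; last exact: mMxE.
    by rewrite -omegaE muleC lee_wpmul2r.
  have MF0 z : (0 <= (M x z * F z)%:E)%E by rewrite lee_fin mulr_ge0.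
  have Mo0 z : (0 <= (M x z * fine omega)%:E)%E by rewrite lee_fin mulr_ge0.
  (* F <= omega is known almost everywhere on each slice of fixed s, so y must be the inner
     variable. *)
  have -> : (\int[mu \x mu]_z (M x z * F z)%:E =
      \int[mu]_s \int[mu]_y (M x (y, s) * F (y, s))%:E)%E.
    exact: (@fubini_tonelli2 _ _ _ _ R mu mu (fun z => (M x z * F z)%:E) mMF MF0).
  have -> : (\int[mu \x mu]_z (M x z * fine omega)%:E =
      \int[mu]_s \int[mu]_y (M x (y, s) * fine omega)%:E)%E.
    exact: (@fubini_tonelli2 _ _ _ _ R mu mu (fun z => (M x z * fine omega)%:E) mMo Mo0).
  apply: ge0_le_integral => //.
  - by move=> s _; apply: integral_ge0 => y _; rewrite lee_fin mulr_ge0.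
  - exact: (@measurable_fun_fubini_tonelli_G _ _ _ _ R mu (fun z => (M x z * F z)%:E) mMF MF0).
  - exact: (@measurable_fun_fubini_tonelli_G _ _ _ _ R mu (fun z => (M x z * fine omega)%:E) mMo Mo0).
  move=> s _; have mp : measurable_fun setT (fun y : R => (y, s)) by exact: measurable_fun_pair.
  apply: ae_ge0_le_integral => //.
  - exact: (measurableT_comp mMF mp).
  - exact: (measurableT_comp mMo mp).
  have [st|st] := boolP (0 < s <= t); last first.
    by apply: aeW => y _; rewrite (Ft _ _ st) mulr0 lee_fin mulr_ge0.
  have := Fo s st; rewrite unlock/= lebesgue_measure_setT_gt0 => /ess_supP.
  apply: ae_imp => y; rewrite omegaE /= lee_fin ger0_norm// => Fy _.
  by rewrite lee_fin ler_wpM2l.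
have r0 : 0 < r by move: r1; rewrite lee_fin; lra.
rewrite lee_fin in r1.
have mFr : measurable_fun setT (fun z => F z `^ r) by exact: (measurableT_comp (measurable_powR _)).
have mMFr : measurable_fun setT (fun u : R * (R * R) => (M u.1 u.2 * F u.2 `^ r)%:E).
  apply/measurable_EFinP; apply: measurable_funM => //.
  exact: (measurableT_comp (measurable_powR _)).
have MFr0 (u : R * (R * R)) : (0 <= (M u.1 u.2 * F u.2 `^ r)%:E)%E.
  by rewrite lee_fin mulr_ge0// powR_ge0.
rewrite unlock/=.
have -> : (L%:E * omega = ((L * fine omega) `^ r)%:E `^ r^-1)%E.
  rewrite poweR_EFin -powRrM mulfV ?lt0r_neq0// powRr1 ?mulr_ge0// ?(ltW L0)//.
  by rewrite omegaE.
apply: ge0_le_poweR; first by rewrite invr_ge0 ltW.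
  by apply: integral_ge0 => x _; rewrite lee_fin powR_ge0.
have step1 : (\int[mu]_x (`|f x| `^ r)%:E <=
    \int[mu]_x ((L `^ (r - 1))%:E * \int[mu \x mu]_z (M x z * F z `^ r)%:E))%E.
  have mI : measurable_fun setT (fun x => \int[mu \x mu]_z (M x z * F z `^ r)%:E)%E.
    exact: (measurable_integral_plane mMFr MFr0).
  apply: ae_le_integralT => //.
  - move=> x; rewrite mule_ge0 ?lee_fin ?powR_ge0//.
    by apply: integral_ge0 => z _; rewrite lee_fin mulr_ge0// powR_ge0.
  - by apply: emeasurable_funM.
  apply: ae_imp fMF => x fx; rewrite -poweR_EFin.
  apply: (le_trans (ge0_le_poweR (ltW r0) _ fx)) => //.
  have J := (@jensen_kernel _ (T * T)%type (mu \x mu)%E (M x) F L r r1 (ltW L0) (mMx x) mF (M0 x) F0 (ML x)). exact: J.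
apply: (le_trans step1).
have I0 x : (0 <= \int[mu \x mu]_z (M x z * F z `^ r)%:E)%E.
  by apply: integral_ge0 => z _; rewrite lee_fin mulr_ge0// powR_ge0.
have mI : measurable_fun setT (fun x => \int[mu \x mu]_z (M x z * F z `^ r)%:E)%E.
  exact: (measurable_integral_plane mMFr MFr0).
rewrite ge0_integralZl_EFin ?powR_ge0//.
rewrite (fubini_tonelli_line_plane mMFr MFr0).
apply: (@le_trans _ _ ((L `^ (r - 1))%:E * \int[mu \x mu]_z ((L / t)%:E * (F z `^ r)%:E))%E).
  apply: lee_wpmul2l; first by rewrite lee_fin powR_ge0.
  apply: ge0_le_integral => //.
  - by move=> z _; apply: integral_ge0 => x _; rewrite lee_fin mulr_ge0// powR_ge0.
  - exact: (measurable_integral_line mMFr MFr0).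
  - by apply: emeasurable_funM => //; exact/measurable_EFinP.
  move=> z _.
  apply: (@le_trans _ _ ((F z `^ r)%:E * \int[mu]_x (M x z)%:E)%E); last first.
    by rewrite muleC lee_wpmul2r// lee_fin powR_ge0.
  rewrite -ge0_integralZl_EFin ?powR_ge0//; last by apply/measurable_EFinP; exact: mMz.
  rewrite le_eqVlt; apply/orP; left; apply/eqP; apply: eq_integral => x _ /=.
  by rewrite -EFinM mulrC.
rewrite ge0_integralZl_EFin//; last 3 first.
- by move=> z _; rewrite lee_fin powR_ge0.
- exact/measurable_EFinP.
- by rewrite divr_ge0// ltW.
have : (\int[mu \x mu]_z (F z `^ r)%:E <= (t * fine omega `^ r)%:E)%E.
  have mFrE : measurable_fun setT (fun z => (F z `^ r)%:E) by exact/measurable_EFinP.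
  have Fr0E z : (0 <= (F z `^ r)%:E)%E by rewrite lee_fin powR_ge0.
  have -> : (\int[mu \x mu]_z (F z `^ r)%:E = \int[mu]_s \int[mu]_y (F (y, s) `^ r)%:E)%E.
    exact: (@fubini_tonelli2 _ _ T T R mu mu (fun z => (F z `^ r)%:E) mFrE Fr0E).
  apply: (@le_trans _ _ (\int[mu]_(s in `[0%R, t]) (fine omega `^ r)%:E)%E); last first.
    rewrite integral_cst//= lebesgue_measure_itv/= lte_fin t0 oppr0 adde0 -EFinM.
    by rewrite mulrC.
  rewrite [leRHS]integral_mkcond; apply: ge0_le_integral => //.
  - by move=> s _; apply: integral_ge0 => y _; rewrite lee_fin powR_ge0.
  - exact: (@measurable_fun_fubini_tonelli_G _ _ T T R mu (fun z => (F z `^ r)%:E) mFrE Fr0E).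
  - by apply/(measurable_restrictT _ _).1 => //; exact: measurable_cst.
  move=> s _; have [st|st] := boolP (0 < s <= t); last first.
    under eq_integral do rewrite (Ft _ _ st) powR0 ?lt0r_neq0//.
    by rewrite integral0 patchE; case: ifP => // _; rewrite lee_fin powR_ge0.
  rewrite patchE mem_set; last by rewrite /= in_itv/=; case/andP: st => /ltW -> ->.
  have := ge0_le_poweR (ltW r0) (Lnorm_ge0 _ _ _) (Fo s st).
  rewrite poweR_Lnorm ?lt0r_neq0// omegaE poweR_EFin => h.
  apply: le_trans h; rewrite le_eqVlt; apply/orP; left; apply/eqP.
  by apply: eq_integral => y _ /=; rewrite ger0_norm.
move=> FI.
apply: (@le_trans _ _ ((L `^ (r - 1))%:E * ((L / t)%:E * (t * fine omega `^ r)%:E))%E).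
  apply: lee_wpmul2l; first by rewrite lee_fin powR_ge0.
  by apply: lee_wpmul2l => //; rewrite lee_fin divr_ge0// ltW.
rewrite -!EFinM lee_fin powRM ?(ltW L0)// -(mulr_powRB1 (ltW L0) r0).
rewrite le_eqVlt; apply/orP; left; apply/eqP; field.
exact: lt0r_neq0.
Qed.

End schur.

(** * The weighted estimate *)

Section assembly.
Context {R : realType}.
Local Notation mu := (@lebesgue_measure R).

(** Tonelli and s = tau phi(y) for fixed y, with z = (y, tau). Outside (-1, 1) phi is 0 and the
    substitution degenerates, hence the vanishing hypothesis. *)
Lemma integral_plane_substitution (Psi : R -> R -> R) :
  measurable_fun setT (fun p : R * R => Psi p.1 p.2) ->
  (forall s y, 0 <= Psi s y) -> (forall s y, ~~ (-1 < y < 1) -> Psi s y = 0) ->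
  (\int[mu]_s \int[mu]_y (Psi s y)%:E =
   \int[mu \x mu]_z (phi z.1 * Psi (z.2 * phi z.1) z.1)%:E)%E.
Proof.
move=> mPsi Psi0 Psiout.
have mPE : measurable_fun setT (fun p : R * R => (Psi p.1 p.2)%:E) by exact/measurable_EFinP.
have P0E (p : R * R) : (0 <= (Psi p.1 p.2)%:E)%E by rewrite lee_fin.
have mphi1 : measurable_fun setT (fun z : R * R => phi z.1).
  exact: (measurableT_comp measurable_phi measurable_fst).
have mQ : measurable_fun setT (fun z : R * R => phi z.1 * Psi (z.2 * phi z.1) z.1).
  apply: measurable_funM => //.
  have mp : measurable_fun setT (fun z : R * R => (z.2 * phi z.1, z.1)).
    by apply: measurable_fun_pair => //; apply: measurable_funM.
  exact: (measurableT_comp mPsi mp).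
have mQE : measurable_fun setT (fun z : R * R => (phi z.1 * Psi (z.2 * phi z.1) z.1)%:E).
  exact/measurable_EFinP.
have Q0E (z : R * R) : (0 <= (phi z.1 * Psi (z.2 * phi z.1) z.1)%:E)%E.
  by rewrite lee_fin mulr_ge0// phi_ge0.
pose T := measurableTypeR R.
have -> : (\int[mu \x mu]_z (phi z.1 * Psi (z.2 * phi z.1) z.1)%:E =
    \int[mu]_y \int[mu]_t (phi y * Psi (t * phi y) y)%:E)%E.
  exact: (@fubini_tonelli1 _ _ T T R mu mu _ mQE Q0E).
have -> : (\int[mu]_s \int[mu]_y (Psi s y)%:E = \int[mu]_y \int[mu]_s (Psi s y)%:E)%E.
  exact: (@fubini_tonelli _ _ T T R mu mu _ mPE P0E).
apply: eq_integral => y _.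
have [yb|yb] := boolP (-1 < y < 1); last first.
  under eq_integral do rewrite (Psiout _ _ yb).
  by under [RHS]eq_integral do rewrite (Psiout _ _ yb) mulr0.
have f0 := phi_gt0 yb.
have mPy : measurable_fun setT (fun s => Psi s y).
  have mp : measurable_fun setT (fun s : R => (s, y)) by exact: measurable_fun_pair.
  exact: (measurableT_comp mPsi mp).
have mPyE : measurable_fun setT (fun s => (Psi s y)%:E) by exact/measurable_EFinP.
have P0y s : (0 <= (Psi s y)%:E)%E by rewrite lee_fin.
transitivity ((phi y)%:E * \int[mu]_t (Psi (phi y * t + 0) y)%:E)%E.
  rewrite (ge0_integral_affine 0 (lt0r_neq0 f0) mPyE P0y).
  by rewrite gtr0_norm// muleA -EFinM mulfV ?mul1e// lt0r_neq0.
rewrite -ge0_integralZl_EFin ?phi_ge0//.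
  by apply: eq_integral => t _; rewrite addr0 [X in Psi X]mulrC -EFinM.
by apply: (measurableT_comp mPyE); exact: measurable_affine.
Qed.

End assembly.

Section weighted_estimate.
Context {R : realType}.
Local Notation mu := (@lebesgue_measure R).
Variables (k : nat) (h xi zeta : R).
Hypotheses (k0 : (0 < k)%N) (h0 : 0 < h) (xi0 : 0 <= xi) (zeta0 : 0 <= zeta).
Let N : R := k.+1%:R.
Let m : R := (subdivisions k)%:R.
Let N0 : 0 < N. Proof. by rewrite /N. Qed.
Let sm : (0 < subdivisions k)%N. Proof. by rewrite /subdivisions addn1. Qed.
Let m0 : 0 < m. Proof. by rewrite /m /subdivisions ltr0n addn1. Qed.

(** 4 N m is the ratio of h phi(x) to the averaging length v0; the other factor is the constant of
    [fdiff_average_le]. *)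
Definition schur_constant : R := 4 * N * m * (2 * (2 * m) ^+ k.+1).

Lemma schur_constant_gt0 : 0 < schur_constant.
Proof. by rewrite !mulr_gt0// exprn_gt0// mulr_gt0. Qed.
Let C0 := schur_constant_gt0.

Definition schur_kernel (x : R) (z : R * R) : R :=
  schur_constant * (phi z.1 * kernel k h x (z.2 * phi z.1) z.1).

Lemma schur_kernel_ge0 x z : 0 <= schur_kernel x z.
Proof. by rewrite mulr_ge0 ?(ltW C0)// mulr_ge0 ?phi_ge0 ?kernel_ge0. Qed.

Lemma measurable_step : measurable_fun setT (fun z : R * R => z.2 * phi z.1).
Proof.
by apply: measurable_funM => //; exact: (measurableT_comp measurable_phi measurable_fst).
Qed.

Lemma measurable_schur_kernel :
  measurable_fun setT (fun u : R * (R * R) => schur_kernel u.1 u.2).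
Proof.
have m2 : measurable_fun setT (fun u : R * (R * R) => u.2) by exact: measurable_snd.
have m21 : measurable_fun setT (fun u : R * (R * R) => u.2.1).
  exact: (measurableT_comp measurable_fst m2).
have mp : measurable_fun setT (fun u : R * (R * R) => (u.1, (u.2.2 * phi u.2.1, u.2.1))).
  apply: measurable_fun_pair => //; apply: measurable_fun_pair => //.
  exact: (measurableT_comp measurable_step m2).
apply: measurable_funM => //; apply: measurable_funM.
  exact: (measurableT_comp measurable_phi m21).
exact: (measurableT_comp (measurable_kernel k h) mp).
Qed.

(** The factor 32 N^2 is inserted so that the two marginals take the forms L and L / h of
    [schur_test]. *)
Lemma integral_schur_kernel_left x :
  (\int[mu \x mu]_z (schur_kernel x z)%:E <= (schur_constant * (32 * N ^+ 2 * h))%:E)%E.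
Proof.
have k0x s y : 0 <= kernel k h x s y by exact: kernel_ge0.
have mkp := measurable_kernel_pair k h x.
have mQ : measurable_fun setT (fun z : R * R => (phi z.1 * kernel k h x (z.2 * phi z.1) z.1)%:E).
  apply/measurable_EFinP; apply: measurable_funM.
    exact: (measurableT_comp measurable_phi measurable_fst).
  have mp : measurable_fun setT (fun z : R * R => (z.2 * phi z.1, z.1)).
    by apply: measurable_fun_pair => //; exact: measurable_step.
  exact: (measurableT_comp mkp mp).
have -> : (\int[mu \x mu]_z (schur_kernel x z)%:E =
    schur_constant%:E * \int[mu \x mu]_z (phi z.1 * kernel k h x (z.2 * phi z.1) z.1)%:E)%E.
  rewrite -ge0_integralZl_EFin ?(ltW C0)//.
  by move=> z _; rewrite lee_fin mulr_ge0 ?phi_ge0 ?kernel_ge0.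
rewrite [leRHS]EFinM; apply: lee_wpmul2l; first by rewrite lee_fin ltW.
rewrite -(@integral_plane_substitution R (kernel k h x)) //; last first.
  move=> s y yb; rewrite /kernel ifF//; apply: contraNF yb => adm.
  by have [] := admissible_bounds k0 h0 adm.
apply: (le_trans (integral_kernel_left k0 h0 x)); rewrite lee_fin ler_peMl ?(ltW h0)//.
have : 1 <= N ^+ 2 by rewrite exprn_ege1// ler1n.
lra.
Qed.

Lemma integral_schur_kernel_right z :
  (\int[mu]_x (schur_kernel x z)%:E <= (schur_constant * (32 * N ^+ 2 * h) / h)%:E)%E.
Proof.
have -> : schur_constant * (32 * N ^+ 2 * h) / h = schur_constant * (32 * N ^+ 2).
  by field; exact: lt0r_neq0.
have mkl := measurable_kernel_left k h (z.2 * phi z.1) z.1.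
have kge0 x : (0 <= (kernel k h x (z.2 * phi z.1) z.1)%:E)%E by rewrite lee_fin kernel_ge0.
have mklE : measurable_fun setT (fun x => (kernel k h x (z.2 * phi z.1) z.1)%:E).
  exact/measurable_EFinP.
have -> : (\int[mu]_x (schur_kernel x z)%:E = schur_constant%:E *
    ((phi z.1)%:E * \int[mu]_x (kernel k h x (z.2 * phi z.1) z.1)%:E))%E.
  have Cf0 : 0 <= schur_constant * phi z.1 by rewrite mulr_ge0 ?phi_ge0 ?(ltW C0).
  rewrite muleA -EFinM -ge0_integralZl_EFin//.
  by apply: eq_integral => x _; rewrite -EFinM -mulrA.
rewrite (EFinM schur_constant (32 * N ^+ 2)); apply: lee_wpmul2l; first by rewrite lee_fin ltW.
exact: integral_kernel_right.
Qed.

(** The small stencil lies in I, hence is farther from both endpoints, and powers with exponents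
    [xi], [zeta] >= 0 preserve this order. Here the signs of r / 2 + alpha and r / 2 + beta
    enter. *)
Lemma shifted_weight_le x s y : admissible k h x s y ->
  shifted_weight (N * h) xi zeta x * distance_weight k s y <=
  (1 - y - k%:R * s / 2) `^ (xi + 2^-1) * (1 + y - k%:R * s / 2) `^ (zeta + 2^-1).
Proof.
move=> adm; have [xb s0 y1 y2 yb] := admissible_bounds k0 h0 adm.
case/and5P: adm => a1 a2 a3 a4 /andP[a5 a6].
set u := 1 - y - k%:R * s / 2; set v := 1 + y - k%:R * s / 2.
have u0 : 0 < u by rewrite /u; lra.
have v0 : 0 < v by rewrite /v; lra.
have half (w e : R) : 0 < w -> w `^ (e + 2^-1) = w `^ e * Num.sqrt w.
  move=> w0; rewrite powRD ?powR12_sqrt ?(ltW w0)//.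
  by apply/implyP => _; exact: lt0r_neq0.
rewrite !half// /distance_weight -/u -/v [leRHS]mulrACA ler_wpM2r ?mulr_ge0 ?sqrtr_ge0//.
rewrite /shifted_weight -!(mulrA N).
apply: ler_pM; rewrite ?powR_ge0//.
- by apply: ge0_ler_powR; rewrite ?nnegrE//; rewrite /u /N in a1 a2 a5 a6 u0 *; lra.
- by apply: ge0_ler_powR; rewrite ?nnegrE//; rewrite /v /N in a1 a2 a5 a6 v0 *; lra.
Qed.

Variables (g G : R -> R).
Hypothesis mG : measurable_fun setT G.
Hypothesis gG : forall x y, -1 < x -> x <= y -> y < 1 ->
  mu.-integrable `]x, y[ (EFin \o G) /\
  (\int[mu]_(u in `]x, y[) (G u)%:E = (g y - g x)%:E)%E.

(** z is (y, tau). Stencils are strictly inside (-1, 1), where a function agrees with its extension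
    by 0; the cut at tau <= h is the support condition of [schur_test]. *)
Definition weighted_diff (z : R * R) : R :=
  if [&& 0 < z.2, z.2 <= h, -1 < z.1 - k%:R * (z.2 * phi z.1) / 2 &
      z.1 + k%:R * (z.2 * phi z.1) / 2 < 1]
  then shifted_weight (k%:R * z.2) (xi + 2^-1) (zeta + 2^-1) z.1 *
       `|fdiff k (z.2 * phi z.1) G (z.1 - k%:R * (z.2 * phi z.1) / 2)|
  else 0.

Lemma weighted_diff_ge0 z : 0 <= weighted_diff z.
Proof.
rewrite /weighted_diff; case: ifP => // _; rewrite mulr_ge0//.
by rewrite /shifted_weight mulr_ge0// powR_ge0.
Qed.

Lemma measurable_weighted_diff : measurable_fun setT weighted_diff.
Proof.
have mks : measurable_fun setT (fun z : R * R => k%:R * (z.2 * phi z.1) / 2).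
  by apply: measurable_funM => //; apply: measurable_funM => //; exact: measurable_step.
have mks' : measurable_fun setT (fun z : R * R => k%:R * z.2 * phi z.1 / 2).
  rewrite (_ : (fun _ => _) = (fun z : R * R => k%:R * (z.2 * phi z.1) / 2)) ; first exact: mks.
  by apply/funext => z; rewrite mulrA.
apply: measurable_fun_ifT => //.
- apply: measurable_and; [|apply: measurable_and; [|apply: measurable_and]].
  + exact: measurable_fun_ltr.
  + exact: measurable_fun_ler.
  + by apply: measurable_fun_ltr => //; exact: measurable_funB.
  + by apply: measurable_fun_ltr => //; exact: measurable_funD.
- apply: measurable_funM.
  + apply: measurable_funM; apply: (measurableT_comp (measurable_powR _));
      apply: measurable_funB => //; [exact: measurable_funB|exact: measurable_funD].
  + have mp : measurable_fun setT (fun z : R * R => (z.2 * phi z.1, z.1)).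
      by apply: measurable_fun_pair => //; exact: measurable_step.
    exact: (measurableT_comp (measurable_centered_fdiff mG k) mp).
Qed.

Definition admissible_diff x s y : R :=
  if admissible k h x s y then `|fdiff k s G (y - k%:R * s / 2)| else 0.

Lemma admissible_diff_ge0 x s y : 0 <= admissible_diff x s y.
Proof. by rewrite /admissible_diff; case: ifP. Qed.

Lemma admissible_diff_out x s y : ~~ (-1 < y < 1) -> admissible_diff x s y = 0.
Proof.
move=> yb; rewrite /admissible_diff; case: ifPn => // adm.
by have [_ _ _ _ yb'] := admissible_bounds k0 h0 adm; rewrite yb' in yb.
Qed.

Lemma measurable_admissible_diff x :
  measurable_fun setT (fun p : R * R => admissible_diff x p.1 p.2).
Proof.
apply: measurable_fun_ifT => //; last exact: measurable_centered_fdiff.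
have mp : measurable_fun setT (fun p : R * R => (x, p)) by exact: measurable_fun_pair.
exact: (measurableT_comp (measurable_admissible k h) mp).
Qed.

Definition plane_diff x (z : R * R) : R :=
  phi z.1 * admissible_diff x (z.2 * phi z.1) z.1.

Lemma plane_diff_ge0 x z : (0 <= (plane_diff x z)%:E)%E.
Proof. by rewrite lee_fin mulr_ge0 ?phi_ge0 ?admissible_diff_ge0. Qed.

Lemma measurable_plane_diff x : measurable_fun setT (fun z => (plane_diff x z)%:E).
Proof.
apply/measurable_EFinP; apply: measurable_funM.
  exact: (measurableT_comp measurable_phi measurable_fst).
have mp : measurable_fun setT (fun z : R * R => (z.2 * phi z.1, z.1)).
  by apply: measurable_fun_pair; [exact: measurable_step|exact: measurable_fst].
exact: (measurableT_comp (measurable_admissible_diff x) mp).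
Qed.

(** [shifted_weight_le] pays for the division by [distance_weight], and [admissible_step_le] gives
    tau <= h, so that [weighted_diff] does not vanish by its cut. *)
Lemma plane_diff_kernel_le x z :
  shifted_weight (N * h) xi zeta x * (schur_constant / (h * phi x)) * plane_diff x z <=
  schur_kernel x z * weighted_diff z.
Proof.
rewrite /schur_kernel /kernel /plane_diff /admissible_diff.
case: ifPn => [adm|_]; last by rewrite !(mulr0, mul0r).
case: z adm => y t /= adm.
have [xb s0 y1 y2 yb] := admissible_bounds k0 h0 adm.
have fy := phi_gt0 yb; have e0 : 0 < h * phi x by rewrite mulr_gt0// phi_gt0.
have wle := shifted_weight_le adm.
have W1 : 0 < distance_weight k (t * phi y) y.
  by rewrite mulr_gt0// sqrtr_gt0; lra.
have tpos : 0 < t by rewrite -(pmulr_lgt0 _ fy).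
have th : t <= h by rewrite -(ler_pM2r fy); exact: (admissible_step_le k0 h0 adm).
rewrite /weighted_diff /= tpos th y1 y2/=.
have -> : shifted_weight (k%:R * t) (xi + 2^-1) (zeta + 2^-1) y =
    (1 - y - k%:R * (t * phi y) / 2) `^ (xi + 2^-1) *
    (1 + y - k%:R * (t * phi y) / 2) `^ (zeta + 2^-1).
  by rewrite /shifted_weight -!(mulrA k%:R).
move: wle W1; set D := `|fdiff _ _ _ _|; set W := shifted_weight _ _ _ _.
set W' := (_ `^ _ * _); set w := distance_weight _ _ _ => wle w0.
have D0 : 0 <= D by exact: normr_ge0.
set e := h * phi x in e0 *.
have -> : W * (schur_constant / e) * (phi y * D) = (schur_constant / e * phi y * D) * W by ring.
have -> : schur_constant * (phi y * (e^-1 * w^-1)) * (W' * D) =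
   (schur_constant / e * phi y * D) * (W' / w) by ring.
apply: ler_wpM2l; last by rewrite ler_pdivlMr.
exact: mulr_ge0 (mulr_ge0 (divr_ge0 (ltW C0) (ltW e0)) (phi_ge0 y)) D0.
Qed.

Lemma fdiff_le_plane_diff x :
  -1 < x - N * (h * phi x) / 2 -> x + N * (h * phi x) / 2 < 1 ->
  (`|fdiff k.+1 (h * phi x) g (x - N * (h * phi x) / 2)|%:E <=
   (schur_constant / (h * phi x))%:E * \int[mu \x mu]_z (plane_diff x z)%:E)%E.
Proof.
set e := h * phi x => xa xb.
have Ne0 : 0 <= N * e by rewrite mulr_ge0 ?mulr_ge0 ?phi_ge0// ltW.
have x1 : -1 < x < 1 by lra.
have e0 : 0 < e by rewrite mulr_gt0// phi_gt0.
set a := x - N * e / 2; set b := x + N * e / 2.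
have gGab u v : a <= u -> u <= v -> v <= b -> mu.-integrable `]u, v[ (EFin \o G) /\
    (\int[mu]_(w in `]u, v[) (G w)%:E = (g v - g u)%:E)%E.
  by move=> au uv vb; apply: gG => //; rewrite /a /b in au vb *; lra.
(* With m (4 N v0) = h phi(x), the range [v0, 4 N v0] of s is exactly the step condition of
   [admissible]. *)
have [v0 v00 v0E] : exists2 v0, 0 < v0 & m * (4 * N * v0) = e.
  exists (e / (4 * N * m)); first by rewrite divr_gt0// !mulr_gt0.
  by field; rewrite !lt0r_neq0.
have abE : a + N * (m * (4 * N * v0)) <= b by rewrite v0E /a /b; lra.
have avg := fdiff_average_le mG gGab v00 sm abE.
rewrite -/N -/m v0E in avg.
have PsiE : (\int[mu]_(s in `[v0, (4 * N * v0)%R]) diff_mass G a b k s =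
    \int[mu]_s \int[mu]_y (admissible_diff x s y)%:E)%E.
  rewrite integral_mkcond; apply: eq_integral => s _; rewrite patchE.
  have sE : (s \in `[v0, 4 * N * v0]%classic) = (e <= 4 * N * m * s) && (m * s <= e).
    have -> : (e <= 4 * N * m * s) = (v0 <= s).
      have Nm0 : 0 < 4 * N * m by rewrite !mulr_gt0.
      rewrite -(ler_pM2l Nm0 v0) -v0E.
      by have -> : m * (4 * N * v0) = 4 * N * m * v0 by ring.
    have -> : (m * s <= e) = (s <= 4 * N * v0) by rewrite -v0E ler_pM2l.
    by apply/idP/idP; rewrite inE/= in_itv.
  rewrite sE; case: ifPn => [se|se].
    apply: eq_integral => y _.
    rewrite /admissible_diff /centered_diff /admissible -/N -/m -/e xa xb/=.
    by rewrite (andP se).1 (andP se).2.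
  rewrite (eq_integral (cst 0%E)) ?integral0// => y _; rewrite /admissible_diff ifF//.
  by apply: contraNF se => /and5P[_ _ -> -> _].
rewrite PsiE in avg.
rewrite (integral_plane_substitution (measurable_admissible_diff x)
  (admissible_diff_ge0 x) (@admissible_diff_out x)) in avg.
have v0E0 : (0 < v0%:E)%E by rewrite lte_fin.
rewrite -(lee_pmul2l (isT : v0%:E \is a fin_num) v0E0) -EFinM; apply: (le_trans avg).
rewrite muleA -!EFinM; apply: lee_wpmul2r.
  by apply: integral_ge0 => z _; exact: plane_diff_ge0.
rewrite lee_fin le_eqVlt; apply/orP; left; apply/eqP.
have -> : v0 = e / (4 * N * m) by rewrite -v0E; field; rewrite !lt0r_neq0.
by rewrite /schur_constant; field; rewrite !lt0r_neq0.
Qed.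

Lemma weighted_fdiff_le x :
  -1 < x - N * (h * phi x) / 2 -> x + N * (h * phi x) / 2 < 1 ->
  (`|shifted_weight (N * h) xi zeta x *
      fdiff k.+1 (h * phi x) g (x - N * (h * phi x) / 2)|%:E <=
    \int[mu \x mu]_z (schur_kernel x z * weighted_diff z)%:E)%E.
Proof.
move=> xa xb; have fle := fdiff_le_plane_diff xa xb.
have W0 : 0 <= shifted_weight (N * h) xi zeta x by rewrite mulr_ge0// powR_ge0.
have Ce0 : 0 <= schur_constant / (h * phi x).
  exact: divr_ge0 (ltW C0) (mulr_ge0 (ltW h0) (phi_ge0 x)).
rewrite normrM (ger0_norm W0) EFinM.
apply: le_trans (lee_wpmul2l _ fle) _; first by rewrite lee_fin.
have mp := @measurable_plane_diff x.
rewrite muleA -EFinM -ge0_integralZl_EFin//; last 2 first.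
- by move=> z _; exact: plane_diff_ge0.
- exact: mulr_ge0.
apply: le_integralT => z.
  by apply: mule_ge0 (plane_diff_ge0 x z); rewrite lee_fin; exact: mulr_ge0.
by rewrite -EFinM lee_fin; exact: plane_diff_kernel_le.
Qed.

End weighted_estimate.

(** * Boundary points, measurability and slices of the modulus *)

Section reduction.
Context {R : realType}.
Local Notation mu := (@lebesgue_measure R).
Implicit Types (p : \bar R) (f g G : R -> R) (delta h s x y : R).

Lemma le_Lnorm p f g : (1 <= p)%E -> (forall x, `|f x| <= `|g x|) ->
  (Lnorm mu p (EFin \o f) <= Lnorm mu p (EFin \o g))%E.
Proof.
case: p => [q||] // q1 fg; rewrite unlock/=; last first.
  rewrite lebesgue_measure_setT_gt0; apply: le_ess_sup.
  by apply: nearW => x; rewrite /= lee_fin.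
have q0 : 0 <= q by rewrite -lee_fin (le_trans _ q1).
apply: ge0_le_poweR; first by rewrite invr_ge0.
  by apply: integral_ge0 => x _; rewrite lee_fin powR_ge0.
apply: le_integralT => x; rewrite lee_fin; first exact: powR_ge0.
by apply: ge0_ler_powR; rewrite ?nnegrE.
Qed.

Lemma sym_diff_fdiff (n : nat) h F x :
  -1 <= x - n%:R * h / 2 -> x + n%:R * h / 2 <= 1 ->
  sym_diff n h F x = fdiff n h F (x - n%:R * h / 2).
Proof.
move=> xa xb; rewrite /sym_diff ifT ?fdiff_sum//.
apply/asboolP => y; rewrite /= !in_itv/= => /andP[ya yb].
by rewrite (le_trans xa ya) (le_trans yb xb).
Qed.

Lemma eq_fdiff_itv (n : nat) h (F H : R -> R) x :
  (forall y, -1 < y < 1 -> F y = H y) -> 0 <= h ->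
  -1 < x -> x + n%:R * h < 1 -> fdiff n h F x = fdiff n h H x.
Proof.
move=> FH h0 xa xb; rewrite !fdiff_sum; apply: eq_bigr => i _; rewrite FH//.
have ih0 : 0 <= i%:R * h by rewrite mulr_ge0.
have inh : i%:R * h <= n%:R * h by rewrite ler_wpM2r// ler_nat -ltnS.
lra.
Qed.

(** [domD] also contains points whose stencil touches an endpoint. There |x| = 1 - delta phi(x) / 2;
    squaring and dividing by 1 - |x| leaves a linear equation for |x|, so these points form a null
    set. *)
Lemma domD_boundary delta x : 0 < delta -> domD delta x ->
  ~~ ((-1 < x - delta * phi x / 2) && (x + delta * phi x / 2 < 1)) ->
  `|x| = (4 - delta ^+ 2) / (4 + delta ^+ 2).
Proof.
move=> d0 [/= xd x1].
have dphi0 : 0 <= delta * phi x by rewrite mulr_ge0 ?phi_ge0 ?ltW.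
have dd : 0 < 4 + delta ^+ 2 by rewrite ltr_pwDl// sqr_ge0.
have ax : `|x| < 1.
  rewrite lt_neqAle; apply/andP; split; last by lra.
  apply/eqP => ax; apply: x1; rewrite /=.
  have : x ^+ 2 = 1 by rewrite -(real_normK (num_real x)) ax expr1n.
  by move/eqP; rewrite sqrf_eq1 => /orP[/eqP ->|/eqP ->]; [right|left].
have x11 : -1 < x < 1 by rewrite -ltr_norml.
move=> nd; have xE : `|x| = 1 - delta * phi x / 2.
  apply/eqP; rewrite eq_le xd/= leNgt; apply: contraNN nd; rewrite ltr_norml; lra.
have p2 : phi x ^+ 2 = (1 - `|x|) * (1 + `|x|).
  rewrite phi_sqr; last by lra.
  by rewrite -[RHS]subr_sqr expr1n (real_normK (num_real x)); ring.
have := congr1 (fun u => 4 * (1 - u) ^+ 2) xE.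
have -> : 4 * (1 - (1 - delta * phi x / 2)) ^+ 2 = delta ^+ 2 * phi x ^+ 2 by field.
rewrite p2; have u0 : 1 - `|x| != 0 by rewrite subr_eq0 gt_eqF.
move: `|x| u0 => u u0 e; apply/eqP; rewrite eq_sym -subr_eq0.
have e' : 4 * (1 - u) = delta ^+ 2 * (1 + u).
  apply: (mulIf u0); rewrite -[LHS]mulrA -expr2 e; ring.
have -> : (4 - delta ^+ 2) / (4 + delta ^+ 2) - u =
    (4 * (1 - u) - delta ^+ 2 * (1 + u)) / (4 + delta ^+ 2).
  by field; exact: lt0r_neq0.
by rewrite e' subrr mul0r.
Qed.

Lemma ae_domD_interior delta : 0 < delta ->
  {ae mu, forall x, domD delta x ->
    (-1 < x - delta * phi x / 2) && (x + delta * phi x / 2 < 1)}.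
Proof.
move=> d0; pose c := (4 - delta ^+ 2) / (4 + delta ^+ 2).
exists ([set c] `|` [set - c]); split.
- by apply: measurableU; exact: measurable_set1.
- apply: countable_lebesgue_measure0; apply: finite_set_countable.
  by rewrite finite_setU; split; exact: finite_set1.
- move=> x /= /not_implyP[xd /negP nx].
  have := domD_boundary d0 xd nx; rewrite -/c => xc.
  have [x0|x0] := leP 0 x; [left|right].
    by rewrite /= -xc ger0_norm.
  by rewrite /= -xc ltr0_norm// opprK.
Qed.


Lemma AC_loc_primitive g (G := (derive1 g) \_ `](-1)%R, 1%R[) :
  AC_loc g -> measurable_fun setT G ->
  forall x y, -1 < x -> x <= y -> y < 1 ->
  mu.-integrable `]x, y[ (EFin \o G) /\
  (\int[mu]_(u in `]x, y[) (G u)%:E = (g y - g x)%:E)%E.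
Proof.
move=> acg mG x y x1 xy y1.
have eG u : u \in `]x, y[%classic -> derive1 g u = G u.
  rewrite inE/= in_itv/= => /andP[xu uy]; rewrite /G patchE ifT// inE/= in_itv/=.
  by rewrite (lt_trans x1 xu) (lt_trans uy y1).
have mg : measurable_fun `]x, y[ (derive1 g).
  by apply: (@eq_measurable_fun _ _ _ _ _ G) => [u /eG ->//|]; exact: measurable_funTS.
have [ig eg] := abs_continuous_FTC2 xy (acg _ _ x1 xy y1) mg; split.
  by apply: eq_integrable ig => // u /eG /= ->.
by rewrite -eg; apply: eq_integral => u /eG ->.
Qed.

(** [in_B] provides measurability of phi^n G; phi has no zero in (-1, 1) and can be divided out
    there. *)
Lemma measurable_phi_quotient n G :
  measurable_fun (`[(-1)%R, 1%R] : set R) (fun x => phi x ^+ n * G x) ->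
  measurable_fun setT (G \_ `](-1)%R, 1%R[).
Proof.
move=> mG; apply/(measurable_restrictT _ _).1 => //.
apply: (@eq_measurable_fun _ _ _ _ _ (fun x => (phi x ^+ n)^-1 * (phi x ^+ n * G x))).
  move=> x; rewrite inE/= in_itv/= => /phi_gt0 fx.
  by rewrite mulKf// expf_neq0// lt0r_neq0.
apply: measurable_funM.
  apply: measurable_funTS; apply: (measurableT_comp measurable_inv).
  by apply: measurable_funX; exact: measurable_phi.
apply: measurable_funS mG => // x; rewrite /= !in_itv/= => /andP[x1 x2].
by rewrite !ltW.
Qed.

Section slices.
Variables (k r : nat) (t alpha beta : R) (p : \bar R) (G : R -> R).
Hypothesis p1 : (1 <= p)%E.

(** The slice tau = s is dominated pointwise by the function that enters [modulus] at step s; the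
    exponents agree since (r + 1) / 2 = r / 2 + 1 / 2. *)
Lemma weighted_diff_slice_le (G0 := G \_ `](-1)%R, 1%R[) h s :
  h <= t -> 0 < s <= h ->
  (Lnorm mu p (fun y =>
     (weighted_diff k h (r%:R / 2 + alpha) (r%:R / 2 + beta) G0 (y, s))%:E) <=
   modulus k r.+1 G t alpha beta p)%E.
Proof.
move=> ht /andP[s0 sh].
pose f y := weighted_diff k h (r%:R / 2 + alpha) (r%:R / 2 + beta) G0 (y, s).
pose f' := (fun x => shifted_weight (k%:R * s) (r.+1%:R / 2 + alpha) (r.+1%:R / 2 + beta) x
   * sym_diff k (s * phi x) G x) \_ (domD (k%:R * s)).
apply: (@le_trans _ _ (Lnorm mu p (EFin \o f'))); last first.
  apply: ereal_sup_ubound; exists s => //=.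
  by rewrite s0 (le_trans sh ht).
apply: (@le_Lnorm p f f' p1) => y.
rewrite /f /weighted_diff /= s0 sh/=.
case: ifPn => [/andP[y1 y2]|_]; last by rewrite normr0.
have kf0 : 0 <= k%:R * (s * phi y) by rewrite !mulr_ge0 ?phi_ge0// ltW.
rewrite /f' patchE mem_set; last first.
  split; first by rewrite /= -mulrA ler_norml; lra.
  by move=> /= [] yE; rewrite yE in y1 y2 kf0; lra.
rewrite (sym_diff_fdiff _ (ltW y1) (ltW y2)).
rewrite (@eq_fdiff_itv k (s * phi y) G0 G (y - k%:R * (s * phi y) / 2)); first last.
- lra.
- by [].
- by rewrite mulr_ge0 ?phi_ge0 ?ltW.
- by move=> z z1; rewrite /G0 patchE mem_set//= in_itv.
have e (a : R) : r.+1%:R / 2 + a = r%:R / 2 + a + 2^-1 by rewrite -natr1; field.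
by rewrite !e !normrM normr_id.
Qed.

End slices.

End reduction.

Theorem lemma1p11 (R : realType) (k r : nat) (p : \bar R) (alpha beta : R)
  (hk : (0 < k)%N) (hp : (1 <= p)%E)
  (halpha : 0 <= r%:R / 2 + alpha) (hbeta : 0 <= r%:R / 2 + beta) :
  exists2 c : R, 0 < c &
    forall f : R -> R,
      in_B r.+1 (jacobi_weight alpha beta) p f ->
      forall t : R, 0 < t ->
        (modulus k.+1 r (derive1n r f) t alpha beta p
         <= (c * t)%:E * modulus k r.+1 (derive1n r.+1 f) t alpha beta p)%E.
Proof.
have c0 : 0 < @schur_constant R k * (32 * k.+1%:R ^+ 2).
  by rewrite mulr_gt0 ?schur_constant_gt0// mulr_gt0// exprn_gt0.
exists (schur_constant k * (32 * k.+1%:R ^+ 2)) => //.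
move=> f [_ acg [mphiG _]] t t0.
pose g := derive1n r f; pose G0 := (derive1n r.+1 f) \_ `](-1)%R, 1%R[.
have mG : measurable_fun setT G0 by exact: measurable_phi_quotient mphiG.
have gG : forall x y, -1 < x -> x <= y -> y < 1 ->
    (@lebesgue_measure R).-integrable `]x, y[ (EFin \o G0) /\
    (\int[@lebesgue_measure R]_(u in `]x, y[) (G0 u)%:E = (g y - g x)%:E)%E.
  exact: AC_loc_primitive acg mG.
have slice h s := @weighted_diff_slice_le R k r t alpha beta p (derive1n r.+1 f) hp h s.
set omega := modulus k r.+1 _ t alpha beta p in slice *.
apply: ge_ereal_sup => _ [h /andP[h0 ht] <-].
have omega0 : (0 <= omega)%E.
  by apply: le_trans (slice h h ht _); rewrite ?Lnorm_ge0// h0 lexx.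
set L := schur_constant k * (32 * k.+1%:R ^+ 2 * h).
have LE : L = schur_constant k * (32 * k.+1%:R ^+ 2) * h by rewrite /L; ring.
have L0 : 0 < L by rewrite LE mulr_gt0.
(* The estimate for one h has the factor h, with omega already taken at t; h <= t then replaces h by
   t. *)
apply: (@le_trans _ _ (L%:E * omega)%E); last first.
  by apply: lee_wpmul2r => //; rewrite lee_fin LE; exact: ler_wpM2l (ltW c0) _ _ ht.
apply: (@schur_test R p omega _ (schur_kernel k h)
  (weighted_diff k h (r%:R / 2 + alpha) (r%:R / 2 + beta) G0) L h) => //.
- exact: measurable_schur_kernel.
- exact: measurable_weighted_diff.
- by move=> x z; exact: schur_kernel_ge0.
- by move=> z; exact: weighted_diff_ge0.
- by move=> x; exact: integral_schur_kernel_left.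
- by move=> z; exact: integral_schur_kernel_right.
(* The boundary points of [domD] are the reason why [schur_test] asks for this bound only almost
   everywhere. *)
- apply: ae_imp (ae_domD_interior (mulr_gt0 (ltr0Sn R k) h0)) => x xd.
  rewrite patchE; case: ifPn => [|_]; last first.
    rewrite normr0; apply: integral_ge0 => z _; rewrite lee_fin mulr_ge0//.
      exact: schur_kernel_ge0.
    exact: weighted_diff_ge0.
  rewrite inE => /xd; rewrite -(mulrA k.+1%:R) => /andP[xa xb].
  rewrite (sym_diff_fdiff _ (ltW xa) (ltW xb)); exact: weighted_fdiff_le.
- by move=> y s sh; rewrite /weighted_diff /= andbA (negbTE sh).
- by move=> s sh; exact: slice.
Qed.
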